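(* There exist a minimal Hausdorff étale groupoid $\mathcal{G}$ and a twist $(\mathcal{E},\imath,\pi)$ over $\mathcal{G}$ such that, writing $\mathcal{I}^{\mathcal{G}}$ for the interior of the isotropy of $\mathcal{G}$ and $\mathcal{I}^{\mathcal{E}}=\pi^{-1}(\mathcal{I}^{\mathcal{G}})$, the induced twist $\mathcal{G}^{(0)}\times\mathbb{T}\xrightarrow{\imath}\mathcal{I}^{\mathcal{E}}\xrightarrow{\pi|_{\mathcal{I}^{\mathcal{E}}}}\mathcal{I}^{\mathcal{G}}$ over $\mathcal{I}^{\mathcal{G}}$ is not induced by a continuous $2$-cocycle.
   Context: $\mathbb{T}$ is the circle group. A groupoid $\mathcal{G}$ is a small category in which every morphism is invertible; $r(\gamma)=\gamma\gamma^{-1}$, $s(\gamma)=\gamma^{-1}\gamma$, $\mathcal{G}^{(0)}=r(\mathcal{G})$ is the unit space, and $\mathcal{G}^{(2)}=\{(\alpha,\beta): s(\alpha)=r(\beta)\}$. A Hausdorff groupoid is a groupoid with a locally compact Hausdorff topology in which multiplication and inversion are continuous. It is étale if $r,s:\mathcal{G}\to\mathcal{G}^{(0)}$ are local homeomorphisms, and minimal if $r(s^{-1}(x))$ is dense in $\mathcal{G}^{(0)}$ for each $x\in\mathcal{G}^{(0)}$. The isotropy is $\mathrm{Iso}(\mathcal{G})=\{\gamma\in\mathcal{G}: r(\gamma)=s(\gamma)\}$, and $\mathcal{I}^{\mathcal{G}}$ denotes its topological interior in $\mathcal{G}$ (for $\mathcal{G}$ étale, $\mathcal{I}^{\mathcal{G}}$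 is an open subgroupoid containing $\mathcal{G}^{(0)}$). Likewise $\mathcal{I}^{\mathcal{E}}$ denotes the interior of $\mathrm{Iso}(\mathcal{E})$, which for a twist equals $\pi^{-1}(\mathcal{I}^{\mathcal{G}})$. A twist $(\mathcal{E},\imath,\pi)$ over a Hausdorff étale groupoid $\mathcal{G}$ is a sequence $\mathcal{G}^{(0)}\times\mathbb{T}\xrightarrow{\imath}\mathcal{E}\xrightarrow{\pi}\mathcal{G}$ such that $\mathcal{E}$ is a Hausdorff groupoid, $\imath$ and $\pi$ are groupoid homomorphisms, $\imath$ is a homeomorphism onto $\pi^{-1}(\mathcal{G}^{(0)})$, $\pi$ is continuous, open and surjective, and the extension is central: $\imath(r(\varepsilon),z)\,\varepsilon=\varepsilon\,\imath(s(\varepsilon),z)$ for all $\varepsilon\in\mathcal{E}$, $z\in\mathbb{T}$. Here $\mathcal{G}^{(0)}$ is identified with $\mathcal{E}^{(0)}=\imath(\mathcal{G}^{(0)}\times\{1\})$, and $\pi(\imath(x,z))=x$. Two twists over $\mathcal{G}$ are isomorphic if there is an isomorphism of topological groupoids between them intertwining the maps $\imath$ and the maps $\pi$. A continuous $2$-cocycle on $\mathcal{G}$ is a continuous map $\varsigma:\mathcal{G}^{(2)}\to\mathbb{T}$ with $\varsigma(\alpha,\beta)\varsigma(\alpha\beta,\gamma)=\varsigma(\alpha,\beta\gamma)\varsigma(\beta,\gamma)$ whenever $(\alpha,\beta),(\beta,\gamma)\in\mathcal{G}^{(2)}$, normalised so that $\varsigma(r(\gamma),\gamma)=1=\varsigma(\gamma,s(\gamma))$.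 It yields the twist $\mathcal{E}_\varsigma=\mathcal{G}\times\mathbb{T}$ (product topology) with $(\alpha,w)(\beta,z)=(\alpha\beta,\varsigma(\alpha,\beta)wz)$, $(\alpha,w)^{-1}=(\alpha^{-1},\overline{\varsigma(\alpha,\alpha^{-1})}\,\overline{w})$, $\imath_\varsigma(x,z)=(x,z)$, $\pi_\varsigma(\gamma,z)=\gamma$. A twist is induced by (comes from) a continuous $2$-cocycle if it is isomorphic to $\mathcal{E}_\varsigma$ for some such $\varsigma$; equivalently, if it is topologically trivial, i.e. $\pi$ admits a continuous global section. *)

(* Defs.v *)
From HB Require Import structures.
From mathcomp Require Import all_boot all_order all_algebra complex.
From mathcomp Require Import ring.
From mathcomp Require Import all_classical all_reals all_analysis.
Set Implicit Arguments.
Unset Strict Implicit.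
Unset Printing Implicit Defensive.
Import Order.TTheory GRing.Theory Num.Theory.
Import numFieldNormedType.Exports.
Local Open Scope classical_set_scope.
Local Open Scope ring_scope.

(* The topology of R[i]^o is the one of the modulus, and subsets such as the
   circle are topologised as subspaces (subtype_topology.v). *)
Definition circle (R : realType) := [set z : R[i]^o | `|z| = 1].
Arguments circle : clear implicits.

Section Circle.
Variable R : realType.
Implicit Types z w : circle R.

Lemma circle1_subproof : (1 : R[i]^o) \in circle R.
Proof. by rewrite inE /circle /= normr1. Qed.

Lemma circleM_subproof z w : (val z * val w : R[i]^o) \in circle R.
Proof.
rewrite inE /circle /=.
by rewrite normrM (set_valP z : `|_| = 1) (set_valP w : `|_| = 1) mulr1.
Qed.

Lemma circleV_subproof z : ((val z)^* : R[i]^o)%R \in circle R.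
Proof. by rewrite inE /circle /= norm_conjC; exact: set_valP z. Qed.

Definition c1 : circle R := SigSub circle1_subproof.
Definition cmul z w : circle R := SigSub (circleM_subproof z w).
Definition cinv z : circle R := SigSub (circleV_subproof z).

Lemma cmulC : commutative cmul.
Proof. by move=> z w; apply: val_inj; rewrite /= mulrC. Qed.
Lemma cmulA : associative cmul.
Proof. by move=> z w u; apply: val_inj; rewrite /= mulrA. Qed.
Lemma c1mul : left_id c1 cmul.
Proof. by move=> z; apply: val_inj; rewrite /= mul1r. Qed.
Lemma cmul1 : right_id c1 cmul.
Proof. by move=> z; rewrite cmulC c1mul. Qed.
Lemma cmulV z : cmul z (cinv z) = c1.
Proof.
by apply: val_inj; rewrite /= -normCK (set_valP z : `|_| = 1) expr1n.
Qed.
Lemma cVmul z : cmul (cinv z) z = c1.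
Proof. by rewrite cmulC cmulV. Qed.
End Circle.
Arguments c1 {R}.

(* A homeomorphism onto its image (with the subspace topology). *)
Definition is_embedding (X Y : topologicalType) (f : X -> Y) : Prop :=
  [/\ injective f, continuous f &
      forall U : set X, open U ->
        exists2 V : set Y, open V & f @` U = range f `&` V].

Definition local_homeomorphism (X Y : topologicalType) (f : X -> Y) : Prop :=
  forall x : X, exists U : set X,
    [/\ open U, U x, open (f @` U) & is_embedding (sigL U f)].

Definition open_map (X Y : topologicalType) (f : X -> Y) : Prop :=
  forall U : set X, open U -> open (f @` U).

(* Arrows-only presentation of a groupoid whose set of arrows is a topological
   space; no compatibility with the topology is required yet. The product
   [gmul] is total, but only its values on composable pairs are specified. *)
Record groupoid := Groupoid {
  arrows :> topologicalType;
  grng : arrows -> arrows;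
  gsrc : arrows -> arrows;
  ginv : arrows -> arrows;
  gmul : arrows -> arrows -> arrows;
  rng_mul : forall a b, gsrc a = grng b -> grng (gmul a b) = grng a;
  src_mul : forall a b, gsrc a = grng b -> gsrc (gmul a b) = gsrc b;
  mulgpdA : forall a b c, gsrc a = grng b -> gsrc b = grng c ->
    gmul (gmul a b) c = gmul a (gmul b c);
  rng_inv : forall a, grng (ginv a) = gsrc a;
  src_inv : forall a, gsrc (ginv a) = grng a;
  mul_inv : forall a, gmul a (ginv a) = grng a;
  inv_mul : forall a, gmul (ginv a) a = gsrc a;
  rng_unit : forall a, gmul (grng a) a = a;
  src_unit : forall a, gmul a (gsrc a) = a }.

Definition composable (G : groupoid) : set (G * G) :=
  [set p | gsrc p.1 = grng p.2].
Arguments composable : clear implicits.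

Definition units (G : groupoid) : set G := range (@grng G).
Arguments units : clear implicits.

Definition isotropy (G : groupoid) : set G := [set a | grng a = gsrc a].
Arguments isotropy : clear implicits.

Definition isotropy_interior (G : groupoid) : set G := (isotropy G)°.
Arguments isotropy_interior : clear implicits.

Section GroupoidTheory.
Variable G : groupoid.
Implicit Types a b c : G.

Lemma rng_rng a : grng (grng a) = grng a.
Proof. by rewrite -{1}(mul_inv a) rng_mul ?rng_inv. Qed.
Lemma src_rng a : gsrc (grng a) = grng a.
Proof. by rewrite -{1}(mul_inv a) src_mul ?rng_inv ?src_inv. Qed.
Lemma rng_src a : grng (gsrc a) = gsrc a.
Proof. by rewrite -{1}(inv_mul a) rng_mul ?src_inv ?rng_inv. Qed.
Lemma src_src a : gsrc (gsrc a) = gsrc a.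
Proof. by rewrite -{1}(inv_mul a) src_mul ?src_inv. Qed.

Lemma mulKgpd a b : gsrc a = grng b -> gmul (ginv a) (gmul a b) = b.
Proof. by move=> ab; rewrite -mulgpdA ?src_inv// inv_mul ab rng_unit. Qed.
Lemma mulgpdK a b : grng a = grng b -> gmul a (gmul (ginv a) b) = b.
Proof.
by move=> ab; rewrite -mulgpdA ?rng_inv ?src_inv// mul_inv ab rng_unit.
Qed.
Lemma inv_unique a b : gsrc a = grng b -> gmul a b = grng a -> b = ginv a.
Proof.
by move=> ab e; rewrite -(mulKgpd ab) e -(src_inv a) src_unit.
Qed.
Lemma invgpdK a : ginv (ginv a) = a.
Proof. by rewrite -(@inv_unique (ginv a) a) ?src_inv// inv_mul rng_inv. Qed.

Lemma rng_subproof a : grng a \in units G.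
Proof. by rewrite inE; exists a. Qed.
Lemma src_subproof a : gsrc a \in units G.
Proof. by rewrite inE; exists (gsrc a) => //; exact: rng_src. Qed.

Definition rng0 a : units G := SigSub (rng_subproof a).
Definition src0 a : units G := SigSub (src_subproof a).
End GroupoidTheory.

Definition hausdorff_groupoid (G : groupoid) : Prop :=
  [/\ hausdorff_space G, locally_compact [set: G],
      {within composable G, continuous (fun p : G * G => gmul p.1 p.2)} &
      continuous (@ginv G)].

Definition etale (G : groupoid) : Prop :=
  local_homeomorphism (@rng0 G) /\ local_homeomorphism (@src0 G).

Record etale_groupoid := EtaleGroupoid {
  etale_base :> groupoid;
  etale_hausdorff : hausdorff_groupoid etale_base;
  etaleP : etale etale_base }.

Definition minimal (G : groupoid) : Prop :=
  forall x : G, units G x ->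
    units G `<=` closure (@grng G @` [set a | gsrc a = x]).

Definition is_hom (G K : groupoid) (f : G -> K) : Prop :=
  forall a b : G, gsrc a = grng b ->
    gsrc (f a) = grng (f b) /\ f (gmul a b) = gmul (f a) (f b).

Section HomTheory.
Variables (G K : groupoid) (f : G -> K).
Hypothesis hf : is_hom f.

Lemma hom_rng a : f (grng a) = grng (f a).
Proof.
have [_ e] := hf (etrans (src_rng a) (esym (rng_rng a))).
have [e1 _] := hf (etrans (src_rng (grng a)) (esym (rng_rng (grng a)))).
rewrite !rng_rng in e1.
have rr : gmul (grng a) (grng a) = grng a.
  by rewrite -[X in gmul X _]rng_rng rng_unit.
have [+ e2] := hf (src_rng a).
rewrite rr in e; have := mulKgpd e1; rewrite -e inv_mul => e3 e4.
by rewrite -e4 e3.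
Qed.

Lemma hom_inv a : f (ginv a) = ginv (f a).
Proof.
have [e1 e2] := hf (esym (rng_inv a)).
by apply: inv_unique => //; rewrite -e2 mul_inv hom_rng.
Qed.
End HomTheory.

Record is_subgroupoid (G : groupoid) (H : set G) : Prop := IsSubgroupoid {
  sub_units : units G `<=` H;
  sub_mul : forall a b, H a -> H b -> gsrc a = grng b -> H (gmul a b);
  sub_inv : forall a, H a -> H (ginv a) }.

Section Subgroupoid.
Variables (G : groupoid) (H : set G) (hH : is_subgroupoid H).
Implicit Types a b c : H.

Lemma sub_rng_subproof a : grng (val a) \in H.
Proof. by rewrite inE; apply: (sub_units hH); exists (val a). Qed.
Lemma sub_src_subproof a : gsrc (val a) \in H.
Proof.
rewrite inE; apply: (sub_units hH).
by have := src_subproof (val a); rewrite inE.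
Qed.
Lemma sub_inv_subproof a : ginv (val a) \in H.
Proof. by rewrite inE; apply: (sub_inv hH); exact: set_valP. Qed.

Let srng a : H := SigSub (sub_rng_subproof a).
Let ssrc a : H := SigSub (sub_src_subproof a).
Let sinv a : H := SigSub (sub_inv_subproof a).
(* The default value [a] is only returned on non-composable pairs. *)
Let smul a b : H := insubd a (gmul (val a) (val b)).

Let vmul a b : ssrc a = srng b -> val (smul a b) = gmul (val a) (val b).
Proof.
move=> /(congr1 val) /= ab; apply: insubdK; rewrite inE.
by apply: (sub_mul hH) => //; exact: set_valP.
Qed.

Let vsub a b : ssrc a = srng b -> gsrc (val a) = grng (val b).
Proof. by move=> /(congr1 val). Qed.

Let sub_rng_mul a b : ssrc a = srng b -> srng (smul a b) = srng a.
Proof.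
by move=> ab; apply: val_inj; rewrite /= (vmul ab) rng_mul ?(vsub ab).
Qed.

Let sub_src_mul a b : ssrc a = srng b -> ssrc (smul a b) = ssrc b.
Proof.
by move=> ab; apply: val_inj; rewrite /= (vmul ab) src_mul ?(vsub ab).
Qed.

Let sub_mulA a b c : ssrc a = srng b -> ssrc b = srng c ->
  smul (smul a b) c = smul a (smul b c).
Proof.
move=> ab bc; apply: val_inj.
rewrite !vmul ?mulgpdA ?(vsub ab) ?(vsub bc)//; first by rewrite sub_rng_mul.
by rewrite sub_src_mul.
Qed.

Let sub_rng_inv a : srng (sinv a) = ssrc a.
Proof. by apply: val_inj; exact: rng_inv. Qed.

Let sub_src_inv a : ssrc (sinv a) = srng a.
Proof. by apply: val_inj; exact: src_inv. Qed.

Let sub_mul_inv a : smul a (sinv a) = srng a.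
Proof. by apply: val_inj; rewrite vmul ?sub_rng_inv//; exact: mul_inv. Qed.

Let sub_inv_mul a : smul (sinv a) a = ssrc a.
Proof. by apply: val_inj; rewrite vmul ?sub_src_inv//; exact: inv_mul. Qed.

Let sub_rng_unit a : smul (srng a) a = a.
Proof.
apply: val_inj; rewrite vmul; first exact: rng_unit.
by apply: val_inj; exact: src_rng.
Qed.

Let sub_src_unit a : smul a (ssrc a) = a.
Proof.
apply: val_inj; rewrite vmul; first exact: src_unit.
by apply: val_inj; rewrite /= rng_src.
Qed.

Definition subgroupoid : groupoid :=
  @Groupoid (set_type H : topologicalType) srng ssrc sinv smul
    sub_rng_mul sub_src_mul sub_mulA sub_rng_inv sub_src_inv
    sub_mul_inv sub_inv_mul sub_rng_unit sub_src_unit.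

Lemma sub_mulE (a b : subgroupoid) : gsrc a = grng b ->
  val (gmul a b : H) = gmul (val a) (val b).
Proof. exact: vmul. Qed.

Lemma sub_units_subproof (u : units subgroupoid) : val (val u) \in units G.
Proof.
by rewrite inE; have [a _ <-] := set_valP u; exists (val a).
Qed.

(* The units of a subgroupoid, seen as units of [G]. *)
Definition sub_unit_incl (u : units subgroupoid) : units G :=
  SigSub (sub_units_subproof u).
End Subgroupoid.

Lemma preimage_subgroupoid (G K : groupoid) (f : G -> K) (hf : is_hom f)
  (H : set K) : is_subgroupoid H -> is_subgroupoid (f @^-1` H).
Proof.
move=> [Hu Hm Hi]; split=> [_ [a _ <-]|a b Ha Hb ab|a Ha] /=.
- by rewrite (hom_rng hf); apply: Hu; exists (f a).
- by have [e1 ->] := hf _ _ ab; exact: Hm.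
- by rewrite (hom_inv hf); exact: Hi.
Qed.

Section EtaleTheory.
Variable G : etale_groupoid.

Lemma rng0_continuous : continuous (@rng0 G).
Proof.
move=> a; have [hr _] := etaleP G; have [U [oU Ua _ [_ cU _]]] := hr a.
move/subspace_sigL_continuousP: cU; rewrite continuous_open_subspace//.
by apply; rewrite inE.
Qed.

Lemma rng_continuous : continuous (@grng G).
Proof.
move=> a; rewrite (_ : @grng G = set_val \o @rng0 G)//.
apply: continuous_comp; first exact: rng0_continuous.
exact: initial_continuous.
Qed.

Lemma rng0_open_near (a : G) (N : set G) : nbhs a N ->
  nbhs (rng0 a) (@rng0 G @` N).
Proof.
move=> aN; have [hr _] := etaleP G; have [U [oU Ua orU [_ _ fU]]] := hr a.
have oN : open ((set_val : U -> G) @^-1` N°).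
  apply: open_comp; last exact: open_interior.
  by move=> *; exact: initial_continuous.
have [V oV e] := fU _ oN.
have e' : range (sigL U (@rng0 G)) = @rng0 G @` U.
  apply/seteqP; split=> [_ [x _ <-]|_ [x Ux <-]].
    by exists (val x) => //; exact: set_valP.
  by exists (SigSub (mem_set Ux)).
have : open (@rng0 G @` U `&` V) by exact: openI.
rewrite -e' -e => o.
apply: (@filterS _ _ _
  (sigL U (@rng0 G) @` ((set_val : U -> G) @^-1` N°))).
  by move=> _ [x /interior_subset Nx <-]; exists (val x).
by apply: open_nbhs_nbhs; split => //; exists (SigSub (mem_set Ua)).
Qed.

Lemma units_open : open (units G).
Proof.
rewrite openE => u uu; rewrite /interior.
have ru : grng u = u by case: uu => x _ <-; exact: rng_rng.
have [hr _] := etaleP G; have [U [oU Uu _ [iU _ _]]] := hr u.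
have nU : nbhs u U by exact: open_nbhs_nbhs.
have nrU : nbhs u (@grng G @^-1` U) by apply: rng_continuous; rewrite ru.
apply: filterS (filterI nU nrU) => g [Ug Urg].
have e : sigL U (@rng0 G) (SigSub (mem_set Ug)) =
         sigL U (@rng0 G) (SigSub (mem_set (Urg : U (grng g)))).
  by apply: val_inj; rewrite /= rng_rng.
by move: (congr1 val (iU _ _ e)) => /= ->; exists g.
Qed.

Lemma mul_open_near (a b : G) (N M : set G) : gsrc a = grng b ->
  nbhs a N -> nbhs b M ->
  nbhs (gmul a b)
    [set g | exists x y, [/\ N x, M y, gsrc x = grng y & g = gmul x y]].
Proof.
move=> ab aN bM; have [_ _ cm ci] := etale_hausdorff G.
have hc : composable G (ginv a, gmul a b).
  by rewrite /composable /= src_inv rng_mul.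
have := iffLR (subspace_continuousP _ _) cm _ hc M.
rewrite /from_subspace nbhs_simpl /= mulKgpd// => /(_ bM).
move=> [[P Q] /= [aP abQ] PQM].
have aP' : nbhs a (@ginv G @^-1` P) by exact: ci.
have abR : nbhs (gmul a b) (@rng0 G @^-1` (@rng0 G @` (N `&` @ginv G @^-1` P))).
  apply: rng0_continuous; rewrite (_ : rng0 (gmul a b) = rng0 a); last first.
    by apply: val_inj; exact: rng_mul.
  by apply: rng0_open_near; exact: filterI.
apply: filterS (filterI abQ abR) => g [Qg [x [Nx Px] /(congr1 val) /= xg]].
exists x, (gmul (ginv x) g); split=> //.
- by apply: (PQM (ginv x, g)) => //; rewrite /composable /= src_inv.
- by rewrite rng_mul ?rng_inv// src_inv.
- by rewrite mulgpdK.
Qed.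

Lemma isotropy_interior_subgroupoid : is_subgroupoid (isotropy_interior G).
Proof.
split=> [|a b aI bI ab|a aI].
- move=> u uu; apply: filterS (open_nbhs_nbhs (conj units_open uu)).
  by move=> _ [x _ <-]; rewrite /isotropy /= rng_rng src_rng.
- apply: filterS (mul_open_near ab aI bI) => _ [x [y [ix iy xy ->]]].
  rewrite /isotropy /= in ix iy *.
  by rewrite rng_mul// src_mul// ix xy iy.
- have [_ _ _ ci] := etale_hausdorff G.
  have : nbhs (ginv a) (@ginv G @^-1` isotropy G) by apply: ci; rewrite invgpdK.
  apply: filterS => x; rewrite /isotropy /= rng_inv src_inv.
  exact: esym.
Qed.
End EtaleTheory.

(* The product of the unit space, as a groupoid of units, with the circle. *)
Section UnitBundle.
Variables (R : realType) (G : groupoid).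
Implicit Types p q : (units G * circle R)%type.

Let brng p : units G * circle R := (p.1, c1).
Let binv p : units G * circle R := (p.1, cinv p.2).
Let bmul p q : units G * circle R := (p.1, cmul p.2 q.2).

Let brng_mul p q : brng p = brng q -> brng (bmul p q) = brng p.
Proof. by []. Qed.
Let bsrc_mul p q : brng p = brng q -> brng (bmul p q) = brng q.
Proof. by []. Qed.
Let bmulA p q u : brng p = brng q -> brng q = brng u ->
  bmul (bmul p q) u = bmul p (bmul q u).
Proof. by rewrite /bmul /= cmulA. Qed.
Let brng_inv p : brng (binv p) = brng p.
Proof. by []. Qed.
Let bmul_inv p : bmul p (binv p) = brng p.
Proof. by rewrite /bmul /= cmulV. Qed.
Let binv_mul p : bmul (binv p) p = brng p.
Proof. by rewrite /bmul /= cVmul. Qed.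
Let brng_unit p : bmul (brng p) p = p.
Proof. by case: p => x z; rewrite /bmul /= c1mul. Qed.
Let bsrc_unit p : bmul p (brng p) = p.
Proof. by case: p => x z; rewrite /bmul /= cmul1. Qed.

Definition unit_bundle : groupoid :=
  @Groupoid (units G * circle R)%type brng brng binv bmul
    brng_mul bsrc_mul bmulA brng_inv brng_inv
    bmul_inv binv_mul brng_unit bsrc_unit.
End UnitBundle.

Record extension (R : realType) (G : groupoid) := Extension {
  ext_gpd :> groupoid;
  ext_iota : unit_bundle R G -> ext_gpd;
  ext_proj : ext_gpd -> G;
  iota_hom : is_hom ext_iota;
  proj_hom : is_hom ext_proj;
  proj_iota : forall x z, ext_proj (ext_iota (x, z)) = val x }.

(* In the centrality axiom the unit [grng e] of E is identified with the unit
   [ext_proj (grng e)] = [grng (ext_proj e)] of G, and likewise for [gsrc e]. *)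
Definition is_twist (R : realType) (G : groupoid) (E : extension R G) : Prop :=
  [/\ hausdorff_groupoid E,
      is_embedding (@ext_iota R G E) /\
        range (@ext_iota R G E) = @ext_proj R G E @^-1` units G,
      [/\ continuous (@ext_proj R G E), open_map (@ext_proj R G E) &
          range (@ext_proj R G E) = [set: G]] &
      forall (e : E) (z : circle R),
        gmul (ext_iota E (rng0 (ext_proj e), z)) e =
        gmul e (ext_iota E (src0 (ext_proj e), z))].

Section Restriction.
Variables (R : realType) (G : groupoid) (E : extension R G).
Variables (H : set G) (hH : is_subgroupoid H).

Let hE : is_subgroupoid (@ext_proj R G E @^-1` H) :=
  preimage_subgroupoid (@proj_hom R G E) hH.
Let HG := subgroupoid hH.
Let HE := subgroupoid hE.

Lemma res_iota_subproof (p : unit_bundle R HG) :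
  ext_iota E (sub_unit_incl p.1, p.2) \in @ext_proj R G E @^-1` H.
Proof. by rewrite inE /= proj_iota; exact: (set_valP (val p.1 : H)). Qed.

Lemma res_proj_subproof (e : HE) : ext_proj (val e) \in H.
Proof. by rewrite inE; exact: (set_valP e). Qed.

Definition res_iota (p : unit_bundle R HG) : HE := SigSub (res_iota_subproof p).
Definition res_proj (e : HE) : HG := SigSub (res_proj_subproof e).

Lemma res_iota_hom : is_hom res_iota.
Proof.
move=> p q pq.
have pq' : gsrc ((sub_unit_incl p.1, p.2) : unit_bundle R G) =
           grng ((sub_unit_incl q.1, q.2) : unit_bundle R G).
  case: pq => e; congr pair.
  by apply: (@val_inj _ _ (units G : Type)); rewrite /= e.
have [e1 e2] := @iota_hom R G E _ _ pq'.
have e3 : gsrc (res_iota p) = grng (res_iota q).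
  by apply: (@val_inj _ _ (@ext_proj R G E @^-1` H : Type)).
split=> //; apply: (@val_inj _ _ (@ext_proj R G E @^-1` H : Type)).
by rewrite sub_mulE.
Qed.

Lemma res_proj_hom : is_hom res_proj.
Proof.
move=> a b ab; have ab' : gsrc (val a) = grng (val b) := congr1 val ab.
have [e1 e2] := @proj_hom R G E _ _ ab'.
have e3 : gsrc (res_proj a) = grng (res_proj b).
  by apply: (@val_inj _ _ (H : Type)).
by split=> //; apply: (@val_inj _ _ (H : Type)); rewrite sub_mulE//= sub_mulE.
Qed.

Lemma res_proj_iota x z : res_proj (res_iota (x, z)) = val x.
Proof. by apply: (@val_inj _ _ (H : Type)); rewrite /= proj_iota. Qed.

Definition restriction : extension R HG :=
  Extension res_iota_hom res_proj_hom res_proj_iota.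
End Restriction.

Record cocycle (R : realType) (G : groupoid) := Cocycle {
  cocfun :> G -> G -> circle R;
  coc_continuous :
    {within composable G, continuous (fun p : G * G => cocfun p.1 p.2)};
  cocP : forall a b c, gsrc a = grng b -> gsrc b = grng c ->
    cmul (cocfun a b) (cocfun (gmul a b) c) =
    cmul (cocfun a (gmul b c)) (cocfun b c);
  coc_rng : forall a, cocfun (grng a) a = c1;
  coc_src : forall a, cocfun a (gsrc a) = c1 }.

Section CocycleExtension.
Variables (R : realType) (G : groupoid) (s : cocycle R G).
Implicit Types p q : (G * circle R)%type.

Let crng p : G * circle R := (grng p.1, c1).
Let csrc p : G * circle R := (gsrc p.1, c1).
Let cinvg p : G * circle R :=
  (ginv p.1, cmul (cinv (s p.1 (ginv p.1))) (cinv p.2)).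
Let cmulg p q : G * circle R :=
  (gmul p.1 q.1, cmul (cmul (s p.1 q.1) p.2) q.2).

Let comp p q : csrc p = crng q -> gsrc p.1 = grng q.1.
Proof. by case. Qed.
Let crng_mul p q : csrc p = crng q -> crng (cmulg p q) = crng p.
Proof. by move=> /comp pq; rewrite /crng /= rng_mul. Qed.
Let csrc_mul p q : csrc p = crng q -> csrc (cmulg p q) = csrc q.
Proof. by move=> /comp pq; rewrite /csrc /= src_mul. Qed.
Let cmulgA p q u : csrc p = crng q -> csrc q = crng u ->
  cmulg (cmulg p q) u = cmulg p (cmulg q u).
Proof.
move=> /comp pq /comp qu; rewrite /cmulg /= mulgpdA//; congr pair.
apply: val_inj; have /(congr1 val) /= := cocP s pq qu.
move=> e; rewrite /=; set A := val p.2; set B := val q.2; set C := val u.2.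
transitivity (val (s p.1 q.1) * val (s (gmul p.1 q.1) u.1) * (A * B * C)).
  by rewrite !mulrA; congr (_ * _ * _); rewrite mulrAC mulrC mulrA.
by rewrite e; ring.
Qed.
Let crng_inv p : crng (cinvg p) = csrc p.
Proof. by rewrite /crng /= rng_inv. Qed.
Let csrc_inv p : csrc (cinvg p) = crng p.
Proof. by rewrite /csrc /= src_inv. Qed.
Let cmul_inv p : cmulg p (cinvg p) = crng p.
Proof.
rewrite /cmulg /crng /= mul_inv; congr pair.
set a := s _ _; set w := p.2.
by rewrite -cmulA (cmulC (cinv a)) (cmulA w) cmulV c1mul cmulV.
Qed.
Let cinv_mul p : cmulg (cinvg p) p = csrc p.
Proof.
rewrite /cmulg /csrc /= inv_mul; congr pair.
have := cocP s (esym (rng_inv p.1)) (src_inv p.1).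
rewrite mul_inv inv_mul coc_rng coc_src cmul1 c1mul => <-.
by rewrite -!cmulA cVmul cmul1 cmulV.
Qed.
Let crng_unit p : cmulg (crng p) p = p.
Proof. by case: p => x z; rewrite /cmulg /= rng_unit coc_rng !c1mul. Qed.
Let csrc_unit p : cmulg p (csrc p) = p.
Proof. by case: p => x z; rewrite /cmulg /= src_unit coc_src cmul1 c1mul. Qed.

Definition cocycle_groupoid : groupoid :=
  @Groupoid (G * circle R)%type crng csrc cinvg cmulg
    crng_mul csrc_mul cmulgA crng_inv csrc_inv
    cmul_inv cinv_mul crng_unit csrc_unit.

Definition coc_iota (p : unit_bundle R G) : cocycle_groupoid := (val p.1, p.2).
Definition coc_proj (p : cocycle_groupoid) : G := p.1.

Lemma coc_iota_hom : is_hom coc_iota.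
Proof.
move=> [x z] [_ w] [<-]; have [a _ xa] := set_valP x.
have rx : grng (val x) = val x by rewrite -xa rng_rng.
have sx : gsrc (val x) = val x by rewrite -xa src_rng.
split; first by congr pair; rewrite /= rx.
rewrite /gmul /= /coc_iota /cmulg /=.
by rewrite -[X in s X _]rx coc_rng c1mul -[X in gmul X _]rx rng_unit.
Qed.

Lemma coc_proj_hom : is_hom coc_proj.
Proof. by move=> p q /comp pq. Qed.

Definition cocycle_extension : extension R G :=
  @Extension R G cocycle_groupoid coc_iota coc_proj
    coc_iota_hom coc_proj_hom (fun _ _ => erefl).
End CocycleExtension.

Definition isomorphic_extensions (R : realType) (G : groupoid)
    (E F : extension R G) : Prop :=
  exists (f : E -> F) (g : F -> E),
    [/\ cancel f g /\ cancel g f, continuous f /\ continuous g, is_hom f,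
        forall p : unit_bundle R G, f (ext_iota E p) = ext_iota F p &
        forall e : E, ext_proj (f e) = ext_proj e].

Definition induced_by_cocycle (R : realType) (G : groupoid)
    (E : extension R G) : Prop :=
  exists s : cocycle R G, isomorphic_extensions E (cocycle_extension s).

(* Main.v *)
(* The groupoid is the transformation groupoid of O(3) x Z/2, taken with the
   discrete topology, acting on the real projective plane RP^2 (Z/2 acts
   trivially); it is minimal because the action is transitive. Over the nontrivial
   element of Z/2 the twist carries the circle bundle (S^2 x T)/{+1,-1} over RP^2,
   whose square is canonically trivial and which is O(3)-equivariant, so that it
   defines a twist. All arrows (x, 1, +-1) lie in the interior of the isotropy; if
   the restricted twist came from a cocycle, this bundle would have a continuous
   section, that is, there would be an odd continuous map from S^2 to T,
   contradicting the Borsuk-Ulam theorem. *)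
Require Import Defs.
From HB Require Import structures.
From mathcomp Require Import all_boot all_order all_algebra complex.
From mathcomp Require Import ring lra.
From mathcomp Require Import all_classical all_reals all_analysis.
Set Implicit Arguments.
Unset Strict Implicit.
Unset Printing Implicit Defensive.
Import Order.TTheory GRing.Theory Num.Theory.
Import numFieldNormedType.Exports.
Local Open Scope classical_set_scope.
Local Open Scope ring_scope.

(** Over the unit space every twist is trivial through [imath], so the obstruction has to live on
    another open piece of the isotropy; the factor Z/2 supplies one, a second copy of RP^2.
    Minimality in turn forces the bundle placed there to be equivariant for a transitive group. The
    unit circle bundle of the complexified tautological line bundle is, since an orthogonal matrix g
    carries a vector t k of the line of k to the vector t k g. The dimension 3 is the least that
    works: for n = 2 the sphere is itself a circle, its identification with T is odd, and the bundle
    is trivial. Lines are encoded as projections and classes as vectors t k, so all spaces are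
    subspaces of matrix spaces instead of quotients. Hausdorffness and continuity are then
    inherited; the price is the openness of the map from the sphere to lines, which is recovered
    from compactness. *)

Section Continuity.
Variables T U V : topologicalType.

Lemma continuous_prod (f : T -> U) (g : T -> V) :
  continuous f -> continuous g -> continuous (fun x => (f x, g x)).
Proof.
move=> cf cg x A [[P Q] /= [fP gQ] PQA].
have h : nbhs x (f @^-1` P `&` g @^-1` Q).
  by apply: filterI; [exact: cf|exact: cg].
by rewrite /nbhs/=; apply: filterS h => y ?; exact: PQA.
Qed.

Lemma continuous_fst : continuous (@fst U V).
Proof.
case=> x y A xA; exists (A, setT) => [|[? ?] []//].
by split=> //; exact: filterT.
Qed.

Lemma continuous_snd : continuous (@snd U V).
Proof.
case=> x y A yA; exists (setT, A) => [|[? ?] []//].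
by split=> //; exact: filterT.
Qed.

Lemma continuousT_comp (f : T -> U) (g : U -> V) :
  continuous f -> continuous g -> continuous (fun x => g (f x)).
Proof. by move=> cf cg x; apply: continuous_comp; [exact: cf|exact: cg]. Qed.
End Continuity.

(** * Odd maps from the sphere to the circle *)

(* The sum of the small angles between successive points (p i, q i) of the unit
   circle is an angle between the first and the last point. *)
Lemma cos_sin_asin_sum (R : realType) (p q : nat -> R) (N : nat) :
  (forall i, (p i) ^+ 2 + (q i) ^+ 2 = 1) ->
  (forall i, (i < N)%N -> 0 < p i.+1 * p i + q i.+1 * q i) ->
  let phi := \sum_(i < N) asin (q i.+1 * p i - p i.+1 * q i) in
  cos phi = p N * p 0 + q N * q 0 /\ sin phi = q N * p 0 - p N * q 0.
Proof.
move=> pq1; elim: N => [_|N IH pos] /=.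
  by rewrite big_ord0 cos0 sin0 -!expr2 pq1 mulrC subrr.
have /IH[c s] : forall i, (i < N)%N -> 0 < p i.+1 * p i + q i.+1 * q i.
  by move=> i iN; apply: pos; rewrite ltnS ltnW.
rewrite big_ord_recr/=; set phi := \sum_(i < N) _ in c s *.
(* Cosine and sine of the angle between two successive points; [0 < C] is what makes this angle
   equal to [asin D]. *)
set C := p N.+1 * p N + q N.+1 * q N; set D := q N.+1 * p N - p N.+1 * q N.
have C0 : 0 < C by exact: pos.
have CD : C ^+ 2 + D ^+ 2 = 1.
  rewrite -[1]mulr1 -{1}(pq1 N) -(pq1 N.+1) /C /D; ring.
have D1 : -1 <= D <= 1.
  rewrite -ler_norml -(@ler_pXn2r _ 2)// ?nnegrE// expr1n real_normK ?num_real//.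
  by rewrite -CD lerDr sqr_ge0.
have sD : sin (asin D) = D by apply: asinK; rewrite in_itv.
have cD : cos (asin D) = C.
  by rewrite cos_asin// -CD addrK sqrtr_sqr ger0_norm// ltW.
rewrite cosD sinD c s sD cD /C /D; have e := pq1 N; split.
- transitivity ((p N.+1 * p 0 + q N.+1 * q 0) * (p N ^+ 2 + q N ^+ 2)).
    ring.
  by rewrite e mulr1.
- transitivity ((q N.+1 * p 0 - p N.+1 * q 0) * (p N ^+ 2 + q N ^+ 2)).
    ring.
  by rewrite e mulr1.
Qed.

Section PlanarBorsukUlam.
Variables (R : realType) (p q : R * R -> R).
Hypotheses (cp : continuous p) (cq : continuous q).
Hypothesis pq1 : forall x, p x ^+ 2 + q x ^+ 2 = 1.

(** The inner product of the values at a point and at its translate by d along the first axis is 1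
    for d = 0; by compactness of the rectangle it stays positive for all small d at once. The range
    of t is [0, 2 pi] because both t and t + pi are used for t in [0, pi]. *)
Lemma uniform_step : exists N : nat, forall (i : nat) (t : R),
  (i < N.+1)%N -> 0 <= t <= pi *+ 2 ->
  0 < p (i.+1%:R / N.+1%:R, t) * p (i%:R / N.+1%:R, t) +
      q (i.+1%:R / N.+1%:R, t) * q (i%:R / N.+1%:R, t).
Proof.
pose H (x : (R * R) * R) :=
  p (x.1.1 + x.2, x.1.2) * p x.1 + q (x.1.1 + x.2, x.1.2) * q x.1.
have cH : continuous H.
  have c1 : continuous (fun x : (R * R) * R => x.1).
    exact: continuous_fst.
  have c2 : continuous (fun x : (R * R) * R => (x.1.1 + x.2, x.1.2)).
    apply: continuous_prod; last first.
      exact: continuousT_comp c1 (@continuous_snd _ _).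
    move=> x; apply: cvgD; last exact: continuous_snd.
    exact: (continuousT_comp c1 (@continuous_fst _ _)).
  move=> x; apply: cvgD; apply: cvgM.
  - exact: (continuousT_comp c2 cp).
  - exact: (continuousT_comp c1 cp).
  - exact: (continuousT_comp c2 cq).
  - exact: (continuousT_comp c1 cq).
have cK : compact (`[0 : R, 1] `*` `[0 : R, pi *+ 2]).
  by apply: compact_setX; exact: segment_compact.
have := iffLR (compact_near_coveringP _) cK R (nbhs (0 : R))
  (fun d x => 0 < H (x, d)) _.
case=> [x _|e /= e0 He].
  have : nbhs (x, 0) [set y | 0 < H y].
    have := cH (x, 0) [set r | 0 < r]; apply; apply: open_nbhs_nbhs.
    split; first exact: open_gt.
    by rewrite /H /= addr0 -surjective_pairing -!expr2 pq1.
  exact.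
have [N eN] : exists N : nat, N.+1%:R^-1 < e.
  have [N _ /(_ N (leqnn _))] := near_infty_natSinv_lt (PosNum e0).
  by exists N.
exists N => i t iN t2.
have := He N.+1%:R^-1.
rewrite /= sub0r normrN ger0_norm ?invr_ge0 ?ler0n//.
move=> /(_ eN (i%:R / N.+1%:R, t)).
rewrite /H /= -[X in i%:R / N.+1%:R + X]mul1r -mulrDl (natr1 i); apply.
split=> /=; rewrite in_itv//=; rewrite divr_ge0 ?ler0n//=.
by rewrite ler_pdivrMr ?ltr0n// mul1r ler_nat ltnW.
Qed.

Hypothesis pole : forall t, p (0, t) = p (0, 0) /\ q (0, t) = q (0, 0).
Hypothesis antipode :
  forall t, p (1, t + pi) = - p (1, t) /\ q (1, t + pi) = - q (1, t).
Hypothesis period :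
  forall x t, p (x, t + pi *+ 2) = p (x, t) /\ q (x, t + pi *+ 2) = q (x, t).

(* The map t |-> (p (1, t), q (1, t)) lifts to a real function phi, relative to
   its value at the pole, by summing angles along the radii. The difference
   phi (t + pi) - phi t changes sign between 0 and pi, hence vanishes somewhere,
   which contradicts oddness. *)
Lemma planar_borsuk_ulam : False.
Proof.
have [N hN] := uniform_step.
pose P i t := p (i%:R / N.+1%:R, t); pose Q i t := q (i%:R / N.+1%:R, t).
pose phi t := \sum_(i < N.+1) asin (Q i.+1 t * P i t - P i.+1 t * Q i t).
have phiE t : 0 <= t <= pi *+ 2 ->
    cos (phi t) = P N.+1 t * P 0 t + Q N.+1 t * Q 0 t /\
    sin (phi t) = Q N.+1 t * P 0 t - P N.+1 t * Q 0 t.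
  move=> t2; apply: (@cos_sin_asin_sum R (P^~ t) (Q^~ t)) => [i|i iN].
    exact: pq1.
  exact: hN.
have cpair (x : R) : continuous (fun t : R => (x, t)).
  by apply: continuous_prod => t; [exact: cvg_cst|exact: cvg_id].
have cP i : continuous (P i) by exact: continuousT_comp (cpair _) cp.
have cQ i : continuous (Q i) by exact: continuousT_comp (cpair _) cq.
have cphi t : 0 <= t <= pi *+ 2 -> {for t, continuous phi}.
  move=> t2; apply: cvg_big => [x|i _]; first exact: add_continuous.
  apply: (@continuous_comp _ _ _ (fun t => _ - _) (@asin R)).
    by apply: cvgB; apply: cvgM; first [exact: cP|exact: cQ].
  have := hN i t (ltn_ord i) t2; rewrite -/(P i t) -/(Q i t).
  rewrite -/(P i.+1 t) -/(Q i.+1 t).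
  (* [asin] is handled inside the open interval (-1, 1) only; [0 < C] and C^2 + D^2 = 1 keep D
     there. *)
  set C := _ + _ => C0; set D := _ - _.
  have CD : C ^+ 2 + D ^+ 2 = 1.
    have e1 : P i t ^+ 2 + Q i t ^+ 2 = 1 by exact: pq1.
    have e2 : P i.+1 t ^+ 2 + Q i.+1 t ^+ 2 = 1 by exact: pq1.
    rewrite -[1]mulr1 -{1}e1 -e2 /C /D; ring.
  apply: continuous_asin.
  rewrite -ltr_norml -(@ltr_pXn2r _ 2)// ?nnegrE// expr1n.
  rewrite real_normK ?num_real//.
  by rewrite -CD ltrDr exprn_gt0.
have pi0 := pi_gt0 R.
pose psi t := phi (t + pi) - phi t.
have cpsi : {within `[0, pi], continuous psi}.
  apply: continuous_in_subspaceT => t; rewrite inE/= in_itv/= => /andP[t0 t1].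
  apply: cvgB; last by apply: cphi; rewrite t0/= (le_trans t1)// mulr2n; lra.
  apply: (@continuous_comp _ _ _ (fun t => t + pi) phi).
    by apply: cvgD; [exact: cvg_id|exact: cvg_cst].
  by apply: cphi; rewrite mulr2n; lra.
(* The sum [phi] involves only values at t, so it is truly 2 pi-periodic and not just modulo 2 pi;
   thus phi (2 pi) = phi 0. *)
have psipi : psi pi = - psi 0.
  rewrite /psi opprB add0r; congr (_ - _).
  rewrite -mulr2n -[pi *+ 2]add0r; apply: eq_bigr => i _.
  by rewrite /P /Q !(proj1 (period _ _)) !(proj2 (period _ _)).
have [] := @IVT R psi 0 pi 0 (ltW pi0) cpsi.
  rewrite psipi ge_min le_max; case: (lerP 0 (psi 0)) => h.
    by rewrite oppr_le0 h orbT.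
  by rewrite oppr_ge0 (ltW h) orbT.
move=> t; rewrite in_itv/= => /andP[t0 t1] /subr0_eq e.
have [c1 s1] : cos (phi t) = P N.+1 t * P 0 t + Q N.+1 t * Q 0 t /\
    sin (phi t) = Q N.+1 t * P 0 t - P N.+1 t * Q 0 t.
  by apply: phiE; rewrite mulr2n; lra.
have [c2 s2] : cos (phi (t + pi)) = 
      P N.+1 (t + pi) * P 0 (t + pi) + Q N.+1 (t + pi) * Q 0 (t + pi) /\
    sin (phi (t + pi)) =
      Q N.+1 (t + pi) * P 0 (t + pi) - P N.+1 (t + pi) * Q 0 (t + pi).
  by apply: phiE; rewrite mulr2n; lra.
move: c1 s1 c2 s2; rewrite e => -> ->; rewrite /P /Q divff ?pnatr_eq0// mul0r.
rewrite (proj1 (pole t)) (proj2 (pole t)) (proj1 (pole (t + pi))).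
rewrite (proj2 (pole (t + pi))) (proj1 (antipode t)) (proj2 (antipode t)).
set A := p (1, t); set B := q (1, t); set a := p (0, 0); set b := q (0, 0).
move=> e1 e2.
have AB : A ^+ 2 + B ^+ 2 = 1 by exact: pq1.
have ab : a ^+ 2 + b ^+ 2 = 1 by exact: pq1.
(* These are the cosine and sine of the common value of [phi] at t and t + pi. Oddness makes each
   equal to its opposite, hence 0, against the norm 1. *)
have : (A * a + B * b) ^+ 2 + (B * a - A * b) ^+ 2 = 1.
  by rewrite -[1]mulr1 -{1}AB -ab; ring.
have -> : A * a + B * b = 0 by lra.
have -> : B * a - A * b = 0 by lra.
by rewrite expr0n/= addr0 => /esym/eqP; rewrite oner_eq0.
Qed.
End PlanarBorsukUlam.

(** * Continuity of complex and matrix operations *)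

Section ComplexContinuity.
Variable R : realType.

Lemma Re_continuous : continuous (@complex.Re R : R[i]^o -> R).
Proof.
move=> z A /nbhs_ballP[e /= e0 eA]; apply/nbhs_ballP; exists (e%:C)%C => /=.
  by rewrite ltcR.
move=> w; rewrite /ball/= => zw; apply: eA; rewrite /ball/= -ltcR.
by rewrite -raddfB (le_lt_trans (normc_ge_Re (z - w)) zw).
Qed.

Lemma Im_continuous : continuous (@complex.Im R : R[i]^o -> R).
Proof.
move=> z A /nbhs_ballP[e /= e0 eA]; apply/nbhs_ballP; exists (e%:C)%C => /=.
  by rewrite ltcR.
move=> w; rewrite /ball/= => zw; apply: eA; rewrite /ball/= -ltcR.
rewrite -raddfB; apply: le_lt_trans zw; rewrite normc_def lecR.
by rewrite -sqrtr_sqr ler_sqrt ?addr_ge0 ?sqr_ge0// lerDr sqr_ge0.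
Qed.

Lemma real_complex_continuous : continuous (real_complex R : R -> R[i]^o).
Proof.
move=> x A /nbhs_ballP[e /= e0 eA]; apply/nbhs_ballP.
(* Radii of balls in [R[i]] are complex numbers; being positive, they are real. *)
have ee : e = (complex.Re e)%:C%C.
  by case: e e0 {eA} => a b; rewrite ltcE/= => /andP[/eqP-> _].
exists (complex.Re e) => /=; first by rewrite -ltcR -ee.
move=> y; rewrite /ball/= => xy; apply: eA.
rewrite /ball/= ee -rmorphB normc_def/= expr0n/= addr0 sqrtr_sqr.
by rewrite ltcR.
Qed.

Lemma conj_continuous : continuous (fun z : R[i]^o => z^* : R[i]^o).
Proof.
move=> z A /nbhs_ballP[e /= e0 eA]; apply/nbhs_ballP; exists e => //= w.
by rewrite /ball/= => zw; apply: eA; rewrite /ball/= -rmorphB/= norm_conjC.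
Qed.
End ComplexContinuity.

Section MatrixContinuity.
Variables (T X : topologicalType) (m n : nat).

Lemma continuous_mx (f : T -> 'M[X]_(m, n)) :
  (forall i j, continuous (fun x => f x i j)) -> continuous f.
Proof.
move=> cf x A [P Pf PA].
have : nbhs x [set y | forall ij : 'I_m * 'I_n, P ij.1 ij.2 (f y ij.1 ij.2)].
  by apply: filter_forall => ij; exact: cf.
by rewrite /nbhs/=; apply: filterS => y Py; apply: PA => i j; exact: (Py (i, j)).
Qed.

Lemma continuous_mxE (f : T -> 'M[X]_(m, n)) i j :
  continuous f -> continuous (fun x => f x i j).
Proof.
move=> cf x A xA; apply: (cf x [set M | A (M i j)]).
exists (fun i' j' => if (i' == i) && (j' == j) then A else setT).
  move=> i' j'; case: ifPn => [/andP[/eqP-> /eqP->]//|_]; exact: filterT.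
by move=> M /(_ i j); rewrite !eqxx.
Qed.
End MatrixContinuity.

Section MatrixOperations.
Variables (K : numFieldType) (T : topologicalType).

Lemma continuousT_add (f g : T -> K^o) :
  continuous f -> continuous g -> continuous (fun x => f x + g x : K^o).
Proof. by move=> cf cg x; apply: cvgD; [exact: cf|exact: cg]. Qed.

Lemma continuousT_mul (f g : T -> K^o) :
  continuous f -> continuous g -> continuous (fun x => f x * g x : K^o).
Proof. by move=> cf cg x; apply: cvgM; [exact: cf|exact: cg]. Qed.

Lemma continuous_scalemx m n (a : T -> K^o) (f : T -> 'M[K^o]_(m, n)) :
  continuous a -> continuous f ->
  continuous (fun x => a x *: f x : 'M[K^o]_(m, n)).
Proof.
move=> ca cf; apply: continuous_mx => i j.
under [F in continuous F]funext do rewrite mxE.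
move=> x; apply: cvgM; [exact: ca|exact: (continuous_mxE cf)].
Qed.

Lemma continuous_addmx m n (f g : T -> 'M[K^o]_(m, n)) :
  continuous f -> continuous g -> 
  continuous (fun x => f x + g x : 'M[K^o]_(m, n)).
Proof.
move=> cf cg; apply: continuous_mx => i j.
under [F in continuous F]funext do rewrite mxE.
move=> x; apply: cvgD; [exact: (continuous_mxE cf)|exact: (continuous_mxE cg)].
Qed.

Lemma continuous_mulmx m n p (f : T -> 'M[K^o]_(m, n))
    (g : T -> 'M[K^o]_(n, p)) :
  continuous f -> continuous g ->
  continuous (fun x => f x *m g x : 'M[K^o]_(m, p)).
Proof.
move=> cf cg; apply: continuous_mx => i j.
under [F in continuous F]funext do rewrite mxE.
move=> x; apply: cvg_big => [y|k _]; first exact: add_continuous.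
by apply: cvgM; [exact: (continuous_mxE cf)|exact: (continuous_mxE cg)].
Qed.

Lemma continuous_trmx m n (f : T -> 'M[K^o]_(m, n)) :
  continuous f -> continuous (fun x => (f x)^T : 'M[K^o]_(n, m)).
Proof.
move=> cf; apply: continuous_mx => i j.
under [F in continuous F]funext do rewrite mxE.
exact: (continuous_mxE cf).
Qed.
End MatrixOperations.

Lemma continuous_map_mx (T X Y : topologicalType) m n (h : X -> Y)
    (f : T -> 'M[X]_(m, n)) :
  continuous h -> continuous f -> continuous (fun x => map_mx h (f x)).
Proof.
move=> ch cf; apply: continuous_mx => i j.
under [F in continuous F]funext do rewrite mxE.
move=> x; apply: (@continuous_comp _ _ _ (fun x => f x i j) h).
  exact: (continuous_mxE cf).
exact: ch.
Qed.

Lemma continuous_set_val (T X : topologicalType) (A : set X) (f : T -> A) :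
  continuous (fun x => val (f x)) -> continuous f.
Proof. by move=> cf; apply/continuous_comp_initial. Qed.

Definition sphere (R : realType) n := [set k : 'rV[R]_n | k *m k^T = 1%:M].
Arguments sphere : clear implicits.

Section BorsukUlam.
Variable R : realType.

(* Spherical coordinates: the polar angle is [x.1 * (pi / 2)]. *)
Let lon (x : R * R) : 'rV[R]_3 := \row_j
  [:: sin (x.1 * (pi / 2)) * cos x.2; sin (x.1 * (pi / 2)) * sin x.2;
      cos (x.1 * (pi / 2))]`_j.

Let lonP x : lon x \in sphere R 3.
Proof.
rewrite inE /sphere/=; apply/matrixP => i j.
rewrite !ord1 !mxE !big_ord_recl big_ord0 !mxE/= /bump/=.
set s := sin (x.1 * _); set c := cos (x.1 * _).
transitivity (s ^+ 2 * (cos x.2 ^+ 2 + sin x.2 ^+ 2) + c ^+ 2); first by ring.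
by rewrite cos2Dsin2 mulr1 addrC cos2Dsin2.
Qed.

Let lonc : continuous lon.
Proof.
have c1 : continuous (fun x : R * R => x.1 * (pi / 2)).
  by move=> x; apply: cvgM; [exact: continuous_fst|exact: cvg_cst].
apply: continuous_mx => i j.
under [F in continuous F]funext do rewrite mxE/=.
case: j => [[|[|[|//]]] ?] /=.
- move=> x; apply: cvgM.
    exact: (continuousT_comp c1 (@continuous_sin R)).
  exact: (continuousT_comp (@continuous_snd _ _) (@continuous_cos R)).
- move=> x; apply: cvgM.
    exact: (continuousT_comp c1 (@continuous_sin R)).
  exact: (continuousT_comp (@continuous_snd _ _) (@continuous_sin R)).
- exact: (continuousT_comp c1 (@continuous_cos R)).
Qed.

(** In the coordinates [lon], [x.1 = 0] is the pole and [x.1 = 1] the equator, where adding pi to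
    the longitude is the antipodal map. The real and imaginary parts of f thus fall under
    [planar_borsuk_ulam]. *)
Lemma no_odd_map_to_circle (f : sphere R 3 -> R[i]^o) :
  continuous f -> (forall k, `|f k| = 1) ->
  (forall k l, val k = - val l -> f k = - f l) -> False.
Proof.
move=> cf f1 fodd.
pose L x : sphere R 3 := SigSub (lonP x).
have cL : continuous L by apply: continuous_set_val; exact: lonc.
have cfL : continuous (fun x => f (L x)) := continuousT_comp cL cf.
have eL x y : lon x = lon y -> f (L x) = f (L y).
  by move=> e; congr f; apply: val_inj.
have oL x y : lon x = - lon y -> f (L x) = - f (L y).
  by move=> e; apply: fodd.
apply: (@planar_borsuk_ulam R (fun x => complex.Re (f (L x)))
         (fun x => complex.Im (f (L x)))).
- exact: continuousT_comp cfL (@Re_continuous R).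
- exact: continuousT_comp cfL (@Im_continuous R).
- move=> x; apply: (@complexI R).
  have := f1 (L x); rewrite normc_def => /(congr1 (fun z => z ^+ 2)).
  by rewrite -rmorphXn/= sqr_sqrtr ?addr_ge0 ?sqr_ge0// expr1n.
- move=> t; rewrite (eL (0, t) (0, 0))//.
  by apply/rowP => j; rewrite !mxE/= mul0r sin0 !mul0r.
- move=> t; rewrite (oL (1, t + pi) (1, t)) ?raddfN//.
  apply/rowP => -[[|[|[|//]]] ?]; rewrite !mxE/= mul1r.
  + by rewrite cosDpi mulrN.
  + by rewrite sinDpi mulrN.
  + by rewrite cos_pihalf oppr0.
- move=> x t; rewrite (eL (x, t + pi *+ 2) (x, t))//.
  have p2 : t + pi *+ 2 = t + pi + pi by rewrite mulr2n addrA.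
  apply/rowP => j; rewrite !mxE/=.
  by rewrite p2 !cosDpi !sinDpi !opprK.
Qed.
End BorsukUlam.

(** * Hausdorff spaces, compactness and local homeomorphisms *)

Lemma cluster_continuous (T U : topologicalType) (f : T -> U) x y :
  continuous f -> cluster (nbhs x) y -> cluster (nbhs (f x)) (f y).
Proof.
move=> cf clxy A B /cf fA /cf fB; have [z [Az Bz]] := clxy _ _ fA fB.
by exists (f z).
Qed.

Lemma hausdorff_prod (T U : topologicalType) :
  hausdorff_space T -> hausdorff_space U -> hausdorff_space (T * U)%type.
Proof.
move=> hT hU [x y] [x' y'] cl; congr pair.
  exact/hT/(cluster_continuous (@continuous_fst _ _) cl).
exact/hU/(cluster_continuous (@continuous_snd _ _) cl).
Qed.

Lemma hausdorff_set_type (T : topologicalType) (A : set T) :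
  hausdorff_space T -> hausdorff_space A.
Proof.
move=> hT x y cl; apply: val_inj; apply: hT.
exact: (cluster_continuous (@initial_continuous _ _ _) cl).
Qed.

Lemma hausdorff_mx (T : topologicalType) m n :
  hausdorff_space T -> hausdorff_space 'M[T]_(m, n).
Proof.
move=> hT A B cl; apply/matrixP => i j; apply: hT.
have c : continuous (fun M : 'M[T]_(m, n) => M i j).
  by apply: (@continuous_mxE _ _ _ _ idfun) => x; exact: cvg_id.
exact: (cluster_continuous c cl).
Qed.

Lemma hausdorff_locally_compact (T : topologicalType) :
  hausdorff_space T -> (forall x : T, exists2 K, nbhs x K & compact K) ->
  locally_compact [set: T].
Proof.
move=> hT h x _; rewrite withinET; have [K xK cK] := h x.
by exists K => //; split => //; exact: compact_closed.
Qed.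

Lemma compact_image (T U : topologicalType) (f : T -> U) (A : set T) :
  continuous f -> compact A -> compact (f @` A).
Proof. by move=> cf; apply: continuous_compact; exact: continuous_subspaceT. Qed.

Lemma discrete_continuous (D : discreteTopologicalType) (T : topologicalType)
  (f : D -> T) : continuous f.
Proof.
move=> x A /nbhs_singleton fA.
by apply: filterS (discrete_set1 x) => _ ->.
Qed.

(** The slices of the product over points of D are open, so continuity can be tested on each of
    them. *)
Lemma continuous_discretel (T U : topologicalType) (D : discreteTopologicalType)
    (f : T * D -> U) :
  (forall d, continuous (fun x => f (x, d))) -> continuous f.
Proof.
move=> cf [x d] A xA; exists ((fun x => f (x, d)) @^-1` A, [set d]) => /=.
  by split; [exact: cf|exact: discrete_set1].
by move=> [y e] /= [? ->].
Qed.

Lemma open_map_fst (T U : topologicalType) : open_map (@fst T U).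
Proof.
move=> W oW; rewrite openE => _ [[x y] Wxy <-].
have [[P Q] /= [xP yQ] PQW] : nbhs (x, y) W by exact: open_nbhs_nbhs.
apply: filterS xP => x' Px'; exists (x', y) => //; apply: PQW; split => //=.
exact: nbhs_singleton.
Qed.

Lemma open_map_local_homeo (T U : topologicalType) (f : T -> U) :
  continuous f -> open_map f ->
  (forall x, exists W, [/\ open W, W x & {in W &, injective f}]) ->
  local_homeomorphism f.
Proof.
move=> cf of_ fi x; have [W [oW Wx Wi]] := fi x; exists W; split => //.
  exact: of_.
split.
- move=> a b /= e; apply: val_inj; apply: Wi => //; exact: valP.
- move=> a; apply: (continuousT_comp (@initial_continuous _ _ _) cf).
- move=> _ [V oV <-]; exists (f @` (W `&` V)); first by apply: of_; exact: openI.
  apply/seteqP; split=> [_ [a Va <-]|_ [[a _ <-] [b [Wb Vb] e]]].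
    by split; [exists a|exists (val a) => //; split => //; exact: set_valP].
  by exists (SigSub (mem_set Wb)).
Qed.

Lemma is_embedding_cancel (T U : topologicalType) (f : T -> U) (g : U -> T) :
  continuous f -> continuous g -> cancel f g -> is_embedding f.
Proof.
move=> cf cg fK; split => // [|W oW]; first exact: can_inj fK.
exists (g @^-1` W); first by move: W oW; exact/continuousP.
apply/seteqP; split=> [_ [x Wx <-]|_ [[x _ <-] Wx]].
  by split; [exists x|rewrite /= fK].
by exists x => //; rewrite /= fK in Wx.
Qed.

(** * Transformation groupoids *)

Section TransformationGroupoid.
Variables (X : topologicalType) (D : discreteTopologicalType).
Variables (one : D) (mul : D -> D -> D) (inv : D -> D).
Hypotheses (mulA : associative mul) (mul1 : left_id one mul).
Hypotheses (mulx1 : right_id one mul).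
Hypotheses (mulV : left_inverse one inv mul) (mulxV : right_inverse one inv mul).
Variable act : X -> D -> X.
Hypotheses (act1 : forall x, act x one = x).
Hypotheses (actM : forall x g h, act (act x g) h = act x (mul g h)).

Implicit Types p q : (X * D)%type.
Let trng p : X * D := (p.1, one).
Let tsrc p : X * D := (act p.1 p.2, one).
Let tinv p : X * D := (act p.1 p.2, inv p.2).
Let tmul p q : X * D := (p.1, mul p.2 q.2).

Let trng_mul p q : tsrc p = trng q -> trng (tmul p q) = trng p.
Proof. by []. Qed.
Let tsrc_mul p q : tsrc p = trng q -> tsrc (tmul p q) = tsrc q.
Proof. by rewrite /tsrc/= -actM => -[->]. Qed.
Let tmulA p q u : tsrc p = trng q -> tsrc q = trng u ->
  tmul (tmul p q) u = tmul p (tmul q u).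
Proof. by rewrite /tmul/= mulA. Qed.
Let trng_inv p : trng (tinv p) = tsrc p.
Proof. by []. Qed.
Let tsrc_inv p : tsrc (tinv p) = trng p.
Proof. by rewrite /tsrc/= actM mulxV act1. Qed.
Let tmul_inv p : tmul p (tinv p) = trng p.
Proof. by rewrite /tmul/= mulxV. Qed.
Let tinv_mul p : tmul (tinv p) p = tsrc p.
Proof. by rewrite /tmul/= mulV. Qed.
Let trng_unit p : tmul (trng p) p = p.
Proof. by case: p => x g; rewrite /tmul/= mul1. Qed.
Let tsrc_unit p : tmul p (tsrc p) = p.
Proof. by case: p => x g; rewrite /tmul/= mulx1. Qed.

Definition transformation_groupoid : groupoid :=
  @Groupoid (X * D)%type trng tsrc tinv tmul
    trng_mul tsrc_mul tmulA trng_inv tsrc_inv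
    tmul_inv tinv_mul trng_unit tsrc_unit.
Notation G := transformation_groupoid.

Lemma transformation_mul_continuous :
  continuous (fun p : G * G => gmul p.1 p.2).
Proof.
apply: continuous_prod => /=.
  exact: (continuousT_comp (@continuous_fst _ _) (@continuous_fst _ _)).
have c2 : continuous (fun p : (X * D) * (X * D) => (p.1.2, p.2.2)).
  apply: continuous_prod.
    exact: (continuousT_comp (@continuous_fst _ _) (@continuous_snd _ _)).
  exact: (continuousT_comp (@continuous_snd _ _) (@continuous_snd _ _)).
have cm : continuous (fun p : D * D => mul p.1 p.2).
  by apply: continuous_discretel => d; exact: discrete_continuous.
exact: continuousT_comp c2 cm.
Qed.

Hypothesis act_continuous : forall g, continuous (act^~ g).

Let inv_continuous : continuous (@ginv G).
Proof.
apply: continuous_discretel => d /=; apply: continuous_prod => //=.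
by move=> x; exact: cvg_cst.
Qed.

Lemma transformation_hausdorff : hausdorff_space X ->
  (forall x : X, exists2 K, nbhs x K & compact K) -> hausdorff_groupoid G.
Proof.
move=> hX kX; have hG : hausdorff_space G.
  by apply: hausdorff_prod => //; exact: discrete_hausdorff.
split => //.
- apply: hausdorff_locally_compact => // -[x d]; have [K xK cK] := kX x.
  exists (K `*` [set d]); last by apply: compact_setX => //; exact: compact_set1.
  by exists (K, [set d]) => //; split => //; exact: discrete_set1.
- by apply: continuous_subspaceT; exact: transformation_mul_continuous.
Qed.

Lemma transformation_unitsP (u : G) : units G u <-> u.2 = one.
Proof.
split=> [[a _ <-]//|]; case: u => x d /= ->.
by exists (x, one).
Qed.

(** Range and source are injective on the open slices with fixed group component. The source is the
    range after inversion, so its continuity and openness follow from those of the range. *)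
Lemma transformation_etale : etale G.
Proof.
have slice (x : G) : open [set y : G | y.2 = x.2].
  rewrite (_ : mkset _ = @snd X D @^-1` [set x.2])//.
  apply: open_comp => [y _|]; first exact: continuous_snd.
  exact: discrete_open.
have crng : continuous (@rng0 G).
  apply: continuous_set_val; apply: continuous_prod; first exact: continuous_fst.
  by move=> x; exact: cvg_cst.
have orng : open_map (@rng0 G).
  move=> W oW.
  rewrite (_ : _ @` _ = (fun u : units G => (val u).1) @^-1` (@fst X D @` W)).
    apply: open_comp; last exact: open_map_fst.
    move=> u _; apply: (continuousT_comp (@initial_continuous _ _ _)
      (@continuous_fst X D)).
  apply/seteqP; split=> [_ [a Wa <-]|u [a Wa e]]; first by exists a.
  exists a => //; apply: val_inj => /=.
  have /transformation_unitsP u1 := set_valP u.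
  by apply: (@injective_projections X D) => /=; [exact: e|exact: esym u1].
have srcE : @src0 G = @rng0 G \o @ginv G.
  by apply/funext => a; apply: val_inj; exact: esym (@rng_inv G a).
split; apply: open_map_local_homeo => //.
- move=> x; exists [set y | y.2 = x.2]; split => //.
  move=> [y d] [z e]; rewrite !inE/= => -> -> /(congr1 val)/=.
  by rewrite /trng/= => -[->].
- rewrite srcE; exact: continuousT_comp inv_continuous crng.
- move=> W oW; rewrite (_ : _ @` _ = @rng0 G @` (@ginv G @^-1` W)).
    by apply: orng; apply: open_comp => // ? _; exact: inv_continuous.
  rewrite srcE; apply/seteqP; split=> _ [a Wa <-]; exists (@ginv G a) => //.
    by rewrite /preimage/mkset invgpdK.
  by rewrite /comp invgpdK.
- move=> x; exists [set y | y.2 = x.2]; split => //.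
  move=> [y d] [z e]; rewrite !inE/= => -> -> /(congr1 val)/=.
  rewrite /tsrc/= => -[] /(congr1 (act^~ (inv x.2))).
  by rewrite !actM mulxV !act1 => ->.
Qed.

Lemma transformation_minimal :
  (forall x y, exists g, act x g = y) -> minimal G.
Proof.
move=> tr x /transformation_unitsP x1 y /transformation_unitsP y1.
(* The arrow (y, g) has range y and source y g, so g must carry y to x. *)
apply: subset_closure; have [g xy] := tr y.1 x.1.
exists (y.1, g) => /=; first by case: x x1 xy => a b /= -> <-.
by case: y y1 {xy} => a b /= ->.
Qed.

(** The slice of all arrows with group component g is open and consists of isotropy. *)
Lemma isotropy_interior_kernel g :
  (forall x, act x g = x) -> forall x, isotropy_interior G (x, g).
Proof.
move=> gk x; exists (setT, [set g]) => /=.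
  by split; [exact: filterT|exact: discrete_set1].
by move=> [y h] [_ /= ->]; rewrite /isotropy/= /trng /tsrc/= gk.
Qed.

End TransformationGroupoid.

(** * Open maps out of compact spaces; compactness of spheres *)

Lemma compact_set_type (T : topologicalType) (A : set T) :
  compact A -> compact [set: A].
Proof.
move=> cA F FF _.
have FA : (set_val @ F) A by apply: (@filterE _ F) => y; exact: set_valP.
have [x [Ax clx]] := cA (set_val @ F) _ FA.
exists (SigSub (mem_set Ax)); split => // B C FB [_ [[V oV <-] Vx VC]].
have : (set_val @ F) (set_val @` B).
  by apply: (@filterS _ F _ B) => // y By; exists y.
move=> /clx /(_ (open_nbhs_nbhs (conj oV Vx))) [_ [[y By <-] Vy]].
by exists y; split => //; exact: VC.
Qed.

(** The complement of f(W) is the image of the complement of the saturation of W, which is closed,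
    hence compact; its image is compact, hence closed. *)
Lemma open_map_compact (T U : topologicalType) (f : T -> U) :
  hausdorff_space U -> compact [set: T] -> continuous f ->
  range f = [set: U] ->
  (forall W, open W -> open (f @^-1` (f @` W))) -> open_map f.
Proof.
move=> hU cT cf fsurj fsat W oW.
rewrite -[_ @` _]setCK openC.
rewrite (_ : ~` _ = f @` ~` (f @^-1` (f @` W))).
  apply: compact_closed => //; apply: compact_image => //.
  apply: (subclosed_compact _ cT) => //.
  by rewrite closedC; exact: fsat.
apply/seteqP; split=> [y|_ [x + <-]//].
have [x _ <-] : range f y by rewrite fsurj.
by move=> fx; exists x.
Qed.

Lemma open_map_prodl (T U V : topologicalType) (f : T -> U) :
  open_map f -> open_map (fun x : T * V => (f x.1, x.2)).
Proof.
move=> of_ W oW; rewrite openE => _ [[x v] Wxv <-].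
have [[P Q] /= [xP vQ] PQW] : nbhs (x, v) W by exact: open_nbhs_nbhs.
exists (f @` P°, Q) => /=.
  split => //; apply: open_nbhs_nbhs; split; last by exists x.
  by apply: of_; exact: open_interior.
move=> [_ v'] [/= [x' /interior_subset Px' <-] Qv'].
by exists (x', v') => //; exact: PQW.
Qed.

Section Sphere.
Variables (R : realType) (n : nat).

Lemma sphere_compact : compact (sphere R n).
Proof.
have cbox : compact [set v : 'rV[R]_n | forall i, v ord0 i \in `[(-1), 1]].
  apply: (@rV_compact _ _ (fun=> `[(-1 : R), 1]%classic)) => _.
  exact: segment_compact.
apply: subclosed_compact cbox _.
- rewrite (_ : sphere R n =
    (fun k : 'rV[R]_n => (k *m k^T) 0 0) @^-1` [set 1]); last first.
    apply/seteqP; split=> k; rewrite /sphere/= => e; first by rewrite e mxE.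
    by apply/matrixP => i j; rewrite !ord1 e mxE.
  apply: preimage_closed; last exact: closed_eq.
  move=> k _; apply: (continuous_mxE (T := 'rV[R]_n)).
  by apply: continuous_mulmx; [|apply: continuous_trmx] => x; exact: cvg_id.
- move=> k /(congr1 (fun A : 'M[R]_1 => A 0 0)); rewrite !mxE eqxx mulr1n => e i.
  rewrite in_itv/= -ler_norml -(@ler_pXn2r _ 2)// ?nnegrE// expr1n.
  rewrite real_normK ?num_real// -e (bigD1 i)//= mxE -expr2 lerDl.
  by apply: sumr_ge0 => j _; rewrite mxE -expr2 sqr_ge0.
Qed.

End Sphere.

(** Reduces to [sphere_compact]: the circle is the image of [sphere R 2] under (a, b) |-> a + i
    b. *)
Lemma circle_compact (R : realType) : compact (circle R).
Proof.
pose h (v : 'rV[R]_2) : R[i]^o := (v 0 0 +i* v 0 1)%C.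
rewrite (_ : circle R = h @` sphere R 2).
  apply: compact_image; last exact: sphere_compact.
  rewrite (_ : h = fun v => (v 0 0)%:C%C + 'i%C * (v 0 1)%:C%C); last first.
    by apply/funext => v; rewrite [LHS]complexE.
  have cv j : continuous (fun v : 'rV[R]_2 => (v 0 j)%:C%C : R[i]^o).
    apply: (@continuousT_comp 'rV[R]_2 R R[i]^o (fun v => v 0 j)
      (real_complex R)).
      by apply: (@continuous_mxE _ _ _ _ idfun) => x; exact: cvg_id.
    exact: real_complex_continuous.
  apply: continuousT_add; first exact: cv.
  by apply: continuousT_mul; [exact: cst_continuous|exact: cv].
have nE (a b : R) : `|(a +i* b)%C| = 1 <-> a * a + b * b = 1.
  rewrite normc_def/= -!expr2; split=> [/complexI|->]; last by rewrite sqrtr1.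
  move=> /(congr1 (fun x => x ^+ 2)).
  by rewrite sqr_sqrtr ?expr1n// addr_ge0 ?sqr_ge0.
apply/seteqP; split=> [[a b] /nE ab|_ [v vS <-]].
  exists (\row_j [:: a; b]`_j); last by rewrite /h !mxE.
  apply/matrixP => i j; rewrite !ord1 !mxE !big_ord_recl big_ord0 !mxE/=.
  by rewrite addr0.
apply/nE; move/(congr1 (fun A : 'M[R]_1 => A 0 0)): vS.
rewrite !mxE eqxx mulr1n !big_ord_recl big_ord0 !mxE addr0 => <-.
by congr (_ + _ * _); congr (v _ _); apply: val_inj.
Qed.

(** * The orthogonal group acting on projective space *)

Section ProjectiveSpace.
Variables (R : realType) (n : nat).

(* The line spanned by a unit vector [k] is encoded as the orthogonal projection
   [k^T *m k] onto it. *)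
Definition projective_space : set 'M[R]_n :=
  (fun k : 'rV[R]_n => k^T *m k) @` sphere R n.
Notation X := (projective_space : Type).

Lemma line_subproof (k : sphere R n) :
  (val k)^T *m val k \in projective_space.
Proof. by rewrite inE; exists (val k) => //; exact: set_valP. Qed.

Definition line (k : sphere R n) : X := SigSub (line_subproof k).

Lemma line_surj (x : X) : exists k, line k = x.
Proof.
have [k kS kx] := set_valP x; exists (SigSub (mem_set kS)).
exact: val_inj.
Qed.

Lemma line_continuous : continuous line.
Proof.
apply: continuous_set_val; apply: continuous_mulmx; last exact: initial_continuous.
apply: continuous_trmx; exact: initial_continuous.
Qed.

Lemma sphereP (k : sphere R n) : val k *m (val k)^T = 1%:M.
Proof. exact: set_valP k. Qed.

Lemma opp_subproof (k : sphere R n) : - val k \in sphere R n.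
Proof. by rewrite inE /sphere/= mulNmx [(- _)^T]linearN/= mulmxN opprK sphereP. Qed.

Definition antipode (k : sphere R n) : sphere R n := SigSub (opp_subproof k).

(** Projecting l onto the line of k gives l = c k, with c the inner product of l and k; unit length
    forces c^2 = 1. *)
Lemma line_eq (k l : sphere R n) : line k = line l -> l = k \/ l = antipode k.
Proof.
move=> /(congr1 val)/= kl.
pose c := (val l *m (val k)^T) 0 0.
have lk : val l = c *: val k.
  rewrite -[LHS]mul1mx -(sphereP l) -mulmxA -kl mulmxA.
  by rewrite [X in X *m _]mx11_scalar mul_scalar_mx.
have : c ^+ 2 == 1.
  have := sphereP l; rewrite lk linearZ/= -scalemxAl -scalemxAr scalerA sphereP.
  move=> /(congr1 (fun A : 'M[R]_1 => A 0 0)); rewrite !mxE eqxx mulr1n mulr1.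
  by rewrite expr2 => ->.
rewrite sqrf_eq1 => /orP[] /eqP c1; [left|right]; apply: val_inj => /=.
  by rewrite lk c1 scale1r.
by rewrite lk c1 scaleN1r.
Qed.

Lemma line_antipode k : line (antipode k) = line k.
Proof. by apply: val_inj; rewrite /= mulmxN [(- _)^T]linearN/= mulNmx opprK. Qed.

Lemma antipode_continuous : continuous antipode.
Proof.
apply: continuous_set_val.
rewrite (_ : (fun k => _) = (fun k : sphere R n => (-1) *: val k)).
  by apply: continuous_scalemx; [exact: cst_continuous|exact: initial_continuous].
by apply/funext => k; rewrite scaleN1r.
Qed.

Lemma projective_space_hausdorff : hausdorff_space X.
Proof.
by apply: hausdorff_set_type; apply: hausdorff_mx; exact: Rhausdorff.
Qed.

Lemma sphere_type_compact : compact [set: sphere R n].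
Proof. by apply: compact_set_type; exact: sphere_compact. Qed.

Lemma projective_space_compact : compact [set: X].
Proof.
have -> : [set: X] = range line.
  apply/seteqP; split=> // x _; have [k <-] := line_surj x.
  by exists k.
apply: compact_image line_continuous sphere_type_compact.
Qed.

Lemma line_open : open_map line.
Proof.
apply: open_map_compact.
- exact: projective_space_hausdorff.
- exact: sphere_type_compact.
- exact: line_continuous.
- by apply/seteqP; split=> // x _; have [k <-] := line_surj x; exists k.
(* By [line_eq], the saturation of W only adds the antipodes of its points. *)
- move=> W oW; rewrite (_ : _ @^-1` _ = W `|` antipode @^-1` W).
    apply: openU => //; apply: open_comp => // k _; exact: antipode_continuous.
  apply/seteqP; split=> [k [l Wl /line_eq[->|->]]|k [Wk|Wk]].
  + by left.
  + right; rewrite /= (_ : antipode _ = l)//; apply: val_inj.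
    by rewrite /= opprK.
  + by exists k.
  + by exists (antipode k) => //; exact: line_antipode.
Qed.

Definition orthogonal_matrices : set 'M[R]_n := [set g | g *m g^T = 1%:M].
Notation O := (orthogonal_matrices : Type).

Lemma orthogonalP (g : O) : val g *m (val g)^T = 1%:M.
Proof. exact: set_valP g. Qed.

Lemma orthogonalT (g : O) : (val g)^T *m val g = 1%:M.
Proof. exact/mulmx1C/orthogonalP. Qed.

Lemma ortho1_subproof : 1%:M \in orthogonal_matrices.
Proof. by rewrite inE /orthogonal_matrices/= mul1mx trmx1. Qed.
Lemma orthoM_subproof (g h : O) : val g *m val h \in orthogonal_matrices.
Proof.
rewrite inE /orthogonal_matrices/= trmx_mul mulmxA -(mulmxA (val g)).
by rewrite orthogonalP mulmx1 orthogonalP.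
Qed.
Lemma orthoV_subproof (g : O) : (val g)^T \in orthogonal_matrices.
Proof. by rewrite inE /orthogonal_matrices/= trmxK orthogonalT. Qed.

(** [bool] under exclusive or is Z/2, with [true] its nontrivial element. *)
Definition signed_orthogonal := discrete_topology (O * bool)%type.
Notation D := signed_orthogonal.

Definition so_one : D := (SigSub ortho1_subproof, false).
Definition so_mul (d e : D) : D :=
  (SigSub (orthoM_subproof d.1 e.1), d.2 (+) e.2).
Definition so_inv (d : D) : D := (SigSub (orthoV_subproof d.1), d.2).

Lemma so_mulA : associative so_mul.
Proof.
move=> d e f; congr pair; last exact: addbA.
by apply: val_inj; rewrite /= mulmxA.
Qed.
Lemma so_1mul : left_id so_one so_mul.
Proof. by case=> g b; congr pair; apply: val_inj; rewrite /= mul1mx. Qed.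
Lemma so_mul1 : right_id so_one so_mul.
Proof.
case=> g b; congr pair; last exact: addbF.
by apply: val_inj; rewrite /= mulmx1.
Qed.
Lemma so_Vmul : left_inverse so_one so_inv so_mul.
Proof.
case=> g b; congr pair; last exact: addbb.
by apply: val_inj; rewrite /= orthogonalT.
Qed.
Lemma so_mulV : right_inverse so_one so_inv so_mul.
Proof.
case=> g b; congr pair; last exact: addbb.
by apply: val_inj; rewrite /= orthogonalP.
Qed.

Lemma rotate_subproof (k : sphere R n) (d : D) :
  val k *m val d.1 \in sphere R n.
Proof.
rewrite inE /sphere/= trmx_mul mulmxA -(mulmxA (val k)).
by rewrite orthogonalP mulmx1 sphereP.
Qed.
Definition rotate k d : sphere R n := SigSub (rotate_subproof k d).

Lemma rotate1 k : rotate k so_one = k.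
Proof. by apply: val_inj; rewrite /= mulmx1. Qed.
Lemma rotateM k d e : rotate (rotate k d) e = rotate k (so_mul d e).
Proof. by apply: val_inj; rewrite /= mulmxA. Qed.

Lemma move_line_subproof (x : X) (d : D) :
  (val d.1)^T *m val x *m val d.1 \in projective_space.
Proof.
have [k <-] := line_surj x; rewrite inE; exists (val (rotate k d)).
  exact: set_valP.
by rewrite /= trmx_mul !mulmxA.
Qed.
Definition move_line x d : X := SigSub (move_line_subproof x d).

Lemma move_lineE k d : move_line (line k) d = line (rotate k d).
Proof. by apply: val_inj; rewrite /= trmx_mul !mulmxA. Qed.

Lemma move_line1 x : move_line x so_one = x.
Proof. by have [k <-] := line_surj x; rewrite move_lineE rotate1. Qed.
Lemma move_lineM x d e : move_line (move_line x d) e = move_line x (so_mul d e).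
Proof. by have [k <-] := line_surj x; rewrite !move_lineE rotateM. Qed.

Lemma move_line_continuous d : continuous (move_line^~ d).
Proof.
apply: continuous_set_val; apply: continuous_mulmx; last exact: cst_continuous.
by apply: continuous_mulmx; [exact: cst_continuous|exact: initial_continuous].
Qed.

(* The reflection in the hyperplane orthogonal to [k - l] maps [k] to [l]. *)
Lemma move_line_trans x y : exists d, move_line x d = y.
Proof.
have [k <-] := line_surj x; have [l <-] := line_surj y.
(* The reflection divides by the squared length of k - l, so k = l is treated apart. *)
have [<-|kl] := eqVneq k l; first by exists so_one; exact: move_line1.
pose a : 'rV[R]_n := val k - val l.
pose s : R := (a *m a^T) 0 0; pose t : R := (val k *m a^T) 0 0.
have kkE := sphereP k; have llE := sphereP l.
have aaE : a *m a^T = s%:M by exact: mx11_scalar.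
have kaE : val k *m a^T = t%:M by exact: mx11_scalar.
have lkE : val l *m (val k)^T = val k *m (val l)^T.
  have tr1 (A : 'M[R]_1) : A^T = A by apply/matrixP => i j; rewrite !ord1 mxE.
  by rewrite -[RHS]tr1 trmx_mul trmxK.
(* For unit vectors, |k - l|^2 = 2 - 2 (k . l) = 2 k . (k - l). Hence the reflection subtracts
   exactly a = k - l from k. *)
have s2t : s = t *+ 2.
  have : a *m a^T = val k *m a^T *+ 2.
    rewrite /a linearB/= mulmxBl !mulmxBr kkE llE lkE mulr2n.
    by rewrite opprB.
  rewrite aaE kaE => /(congr1 (fun A : 'M[R]_1 => A 0 0)).
  by rewrite !mxE eqxx !mulr1n.
have s0 : s != 0.
  apply: contra kl => /eqP s0; rewrite -val_eqE/= -subr_eq0; apply/eqP/rowP => j.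
  have : s = \sum_i a 0 i ^+ 2.
    by rewrite /s mxE; apply: eq_bigr => i _; rewrite [a^T _ _]mxE expr2.
  rewrite s0 => /esym/eqP; rewrite psumr_eq0 => [|i _]; last exact: sqr_ge0.
  move=> /allP/(_ j); rewrite mem_index_enum => /(_ isT).
  by rewrite /= sqrf_eq0 => /eqP ->; rewrite mxE.
(* Q is twice the orthogonal projection onto the line of a, whence Q^2 = 2 Q and the orthogonality
   of 1 - Q. *)
pose Q : 'M[R]_n := (2 / s) *: (a^T *m a); pose g := 1%:M - Q.
have QT : Q^T = Q by rewrite /Q linearZ/= trmx_mul trmxK.
have QQ : Q *m Q = Q *+ 2.
  rewrite /Q -scalemxAl -scalemxAr -mulmxA (mulmxA a) aaE.
  rewrite mul_scalar_mx -scalemxAr !scalerA [RHS]mulr2n -scalerDl.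
  by congr (_ *: _); field.
have gO : g \in orthogonal_matrices.
  rewrite inE /orthogonal_matrices/= /g linearB/= trmx1 QT.
  rewrite mulmxBl mul1mx mulmxBr mulmx1 QQ mulr2n.
  by rewrite opprB addrK subrK.
exists ((SigSub gO, false) : D); rewrite move_lineE; congr line; apply: val_inj.
rewrite /= /g /Q mulmxBr mulmx1 -scalemxAr mulmxA kaE mul_scalar_mx scalerA.
rewrite (_ : 2 / s * t = 1) ?scale1r; first by rewrite /a opprB addrC subrK.
have t0 : t != 0 by apply: contra s0 => /eqP t0; rewrite s2t t0 mul0rn.
by rewrite s2t -mulr_natl; field.
Qed.

Definition projective_groupoid : groupoid :=
  transformation_groupoid so_mulA so_1mul so_mul1 so_Vmul so_mulV
    move_line1 move_lineM.
Notation G := projective_groupoid.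

Lemma projective_groupoid_hausdorff : hausdorff_groupoid G.
Proof.
apply: transformation_hausdorff; first exact: move_line_continuous.
  exact: projective_space_hausdorff.
by move=> x; exists setT; [exact: filterT|exact: projective_space_compact].
Qed.

Definition projective_etale : etale_groupoid :=
  EtaleGroupoid projective_groupoid_hausdorff
    (transformation_etale _ _ _ _ _ _ _ move_line_continuous).

Lemma projective_minimal : minimal G.
Proof. by apply: transformation_minimal; exact: move_line_trans. Qed.
End ProjectiveSpace.

(** * The twist *)

Section Twist.
Variables (R : realType) (n : nat).
Notation C := (R[i]^o).
Notation S := (sphere R n : Type).
Notation D := (signed_orthogonal R n).
Notation G := (projective_groupoid R n).
Notation W := (C * 'rV[C]_n)%type.

Definition complexify m (A : 'M[R]_(m, n)) : 'M[C]_(m, n) :=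
  map_mx (real_complex R) A.

(** Bilinear and not Hermitian: the pairing of s k and t k must be s t for phases to multiply. *)
Definition dot (u v : 'rV[C]_n) : C := (u *m v^T) 0 0.

(* An element of the fibre of the twist over an arrow with range [line k] and
   Z/2-component [b] is encoded as (t, 0) or (0, t k) in C x C^n, with |t| = 1:
   the class of (k, t) in (S x T)/{+1,-1} is determined by t k. The product
   [fib_mul] is that of the graded algebra C + C k with k^2 = 1; it is polynomial
   in all of C x C^n, hence continuous. *)
Definition fib (k : 'rV[R]_n) (b : bool) (t : C) : W :=
  if b then (0, t *: complexify k) else (t, 0).

Definition fib_mul (w w' : W) : W :=
  (w.1 * w'.1 + dot w.2 w'.2, w.1 *: w'.2 + w'.1 *: w.2).
Definition fib_act (w : W) (g : 'M[R]_n) : W := (w.1, w.2 *m complexify g).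
(** Conjugation fixes the real vector k and inverts the phase, so it gives inverses within a
    fibre. *)
Definition fib_conj (w : W) : W := (w.1^*, map_mx (fun z => z^*) w.2).

Lemma dot0v v : dot 0 v = 0.
Proof. by rewrite /dot mul0mx mxE. Qed.
Lemma dotv0 v : dot v 0 = 0.
Proof. by rewrite /dot trmx0 mulmx0 mxE. Qed.

Lemma dot_complexify s t k : sphere R n k ->
  dot (s *: complexify k) (t *: complexify k) = s * t.
Proof.
move=> kS; rewrite /dot linearZ/= -scalemxAl -scalemxAr !mxE.
rewrite (_ : \sum_j _ = 1) ?mulr1//.
have := congr1 (fun A : 'M[R]_1 => real_complex R (A 0 0)) kS.
rewrite !mxE eqxx mulr1n rmorph1 => <-; rewrite rmorph_sum.
by apply: eq_bigr => j _; rewrite !mxE rmorphM.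
Qed.

Lemma fibM k b c s t : sphere R n k ->
  fib_mul (fib k b s) (fib k c t) = fib k (b (+) c) (s * t).
Proof.
move=> kS; case: b c => [] [] /=; rewrite /fib_mul/= ?dot0v ?dotv0.
- by rewrite dot_complexify// mul0r add0r !scale0r addr0.
- by rewrite mul0r addr0 scaler0 add0r scalerA mulrC.
- by rewrite mulr0 addr0 scale0r addr0 scalerA.
- by rewrite addr0 !scaler0 addr0.
Qed.

Lemma fib_actE k b t g : fib_act (fib k b t) g = fib (k *m g) b t.
Proof.
case: b; rewrite /fib_act /fib/= ?mul0mx//.
by rewrite -scalemxAl /complexify map_mxM.
Qed.

Lemma fib_conjE k b t : fib_conj (fib k b t) = fib k b t^*.
Proof.
case: b; rewrite /fib_conj /fib/=; congr pair; rewrite ?rmorph0//.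
  apply/matrixP => i j; rewrite !mxE rmorphM/=; congr (_ * _).
  exact: conjc_real.
by apply/matrixP => i j; rewrite !mxE rmorph0.
Qed.

(** The identification by {+1,-1}: over [true] the pairs (k, t) and (-k, -t) agree, while over
    [false] the sign of k is invisible. *)
Lemma fib_opp k b t : fib (- k) b t = fib k b (if b then - t else t).
Proof.
by case: b => //; rewrite /fib /complexify map_mxN scalerN scaleNr.
Qed.

Lemma fib_continuous b :
  continuous (fun p : S * circle R => fib (val p.1) b (val p.2)).
Proof.
have cv1 : continuous (fun p : S * circle R => val p.1).
  exact: continuousT_comp (@continuous_fst _ _) (@initial_continuous _ _ _).
have cv2 : continuous (fun p : S * circle R => val p.2).
  exact: continuousT_comp (@continuous_snd _ _) (@initial_continuous _ _ _).
case: b; apply: continuous_prod => //=; try exact: cst_continuous.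
apply: continuous_scalemx => //; apply: continuous_map_mx => //.
exact: real_complex_continuous.
Qed.

Lemma complexify_continuous (T : topologicalType) m (f : T -> 'M[R]_(m, n)) :
  continuous f -> continuous (fun x => complexify (f x)).
Proof.
by move=> cf; apply: continuous_map_mx => //; exact: real_complex_continuous.
Qed.

Lemma continuous_dot (T : topologicalType) (u v : T -> 'rV[C]_n) :
  continuous u -> continuous v -> continuous (fun x => dot (u x) (v x)).
Proof.
move=> cu cv.
exact: continuous_mxE (continuous_mulmx cu (continuous_trmx cv)).
Qed.

Lemma fib_mul_continuous (T : topologicalType) (f g : T -> W) :
  continuous f -> continuous g -> continuous (fun x => fib_mul (f x) (g x)).
Proof.
move=> cf cg.
have cf1 := continuousT_comp cf (@continuous_fst _ _).
have cf2 := continuousT_comp cf (@continuous_snd _ _).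
have cg1 := continuousT_comp cg (@continuous_fst _ _).
have cg2 := continuousT_comp cg (@continuous_snd _ _).
apply: continuous_prod.
  exact: (continuousT_add (continuousT_mul cf1 cg1) (continuous_dot cf2 cg2)).
exact: (continuous_addmx (continuous_scalemx cf1 cg2)
  (continuous_scalemx cg1 cf2)).
Qed.

Lemma fib_act_continuous (T : topologicalType) (f : T -> W) (g : T -> 'M[R]_n) :
  continuous f -> continuous g -> continuous (fun x => fib_act (f x) (g x)).
Proof.
move=> cf cg; apply: continuous_prod.
  exact: continuousT_comp cf (@continuous_fst _ _).
exact: (continuous_mulmx (continuousT_comp cf (@continuous_snd _ _))
  (complexify_continuous cg)).
Qed.

Lemma fib_conj_continuous : continuous fib_conj.
Proof.
apply: continuous_prod.
  exact: continuousT_comp (@continuous_fst _ _) (@conj_continuous R).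
apply: continuous_map_mx; last exact: continuous_snd.
exact: conj_continuous.
Qed.

Let raw (p : S * D * circle R) : G * W :=
  ((line p.1.1, p.1.2), fib (val p.1.1) p.1.2.2 (val p.2)).

Definition twist_arrows : set (G * W) := range raw.
Notation A := (twist_arrows : Type).

Lemma twist_elt_subproof k d t : raw (k, d, t) \in twist_arrows.
Proof. by rewrite inE; exists (k, d, t). Qed.
Definition twist_elt k d t : A := SigSub (twist_elt_subproof k d t).

Lemma twist_elt_surj (a : A) : exists k d t, a = twist_elt k d t.
Proof.
have [[[k d] t] _ e] := set_valP a; exists k, d, t.
by apply: val_inj; rewrite /= e.
Qed.

Lemma copp_subproof (t : circle R) : - val t \in circle R.
Proof. by rewrite inE /circle/= normrN; exact: (set_valP t). Qed.

Lemma twist_elt_antipode k d t :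
  exists s, twist_elt (antipode k) d t = twist_elt k d s.
Proof.
exists (if d.2 then SigSub (copp_subproof t) else t); apply: val_inj.
by rewrite /= /raw/= line_antipode fib_opp; case: (d.2).
Qed.

(** A change of representative of the line is absorbed by the phase. *)
Lemma twist_elt_line k l d t : line l = line k ->
  exists s, twist_elt l d t = twist_elt k d s.
Proof.
by move=> /esym/line_eq[->|->]; [exists t|exact: twist_elt_antipode].
Qed.

Let so_mat (d : D) : 'M[R]_n := val d.1.
Let rrng (a : G * W) : G * W := (grng a.1, (1, 0)).
Let rsrc (a : G * W) : G * W := (gsrc a.1, (1, 0)).
Let rinv (a : G * W) : G * W :=
  (ginv a.1, fib_act (fib_conj a.2) (so_mat a.1.2)).
(** The fibre component of b lies over the source of a; the transpose, which is the inverse matrix,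
    brings it back to the range of a before the product is taken. *)
Let rmul (a b : G * W) : G * W :=
  (gmul a.1 b.1, fib_mul a.2 (fib_act b.2 (so_mat a.1.2)^T)).

Let rrngE k d t : rrng (raw (k, d, t)) = raw (k, so_one R n, c1).
Proof. by []. Qed.
Let rsrcE k d t : rsrc (raw (k, d, t)) = raw (rotate k d, so_one R n, c1).
Proof. by rewrite /rsrc /raw/= move_lineE. Qed.
Let rinvE k d t : rinv (raw (k, d, t)) = raw (rotate k d, so_inv d, cinv t).
Proof. by rewrite /rinv /raw/= move_lineE fib_conjE fib_actE. Qed.
Let rmulE k d e s t :
  rmul (raw (k, d, s)) (raw (rotate k d, e, t)) = raw (k, so_mul d e, cmul s t).
Proof.
rewrite /rmul /raw/= fib_actE /so_mat -mulmxA orthogonalP mulmx1 fibM//.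
exact: set_valP.
Qed.

Lemma twist_rng_subproof (a : A) : rrng (val a) \in twist_arrows.
Proof.
have [k [d [t ->]]] := twist_elt_surj a; rewrite rrngE; exact: twist_elt_subproof.
Qed.
Lemma twist_src_subproof (a : A) : rsrc (val a) \in twist_arrows.
Proof.
have [k [d [t ->]]] := twist_elt_surj a; rewrite rsrcE; exact: twist_elt_subproof.
Qed.
Lemma twist_inv_subproof (a : A) : rinv (val a) \in twist_arrows.
Proof.
have [k [d [t ->]]] := twist_elt_surj a; rewrite rinvE; exact: twist_elt_subproof.
Qed.

Let erng (a : A) : A := SigSub (twist_rng_subproof a).
Let esrc (a : A) : A := SigSub (twist_src_subproof a).
Let einv (a : A) : A := SigSub (twist_inv_subproof a).
(* The default value [a] is only returned on non-composable pairs. *)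
Let emul (a b : A) : A := insubd a (rmul (val a) (val b)).

Let erngE k d t : erng (twist_elt k d t) = twist_elt k (so_one R n) c1.
Proof. by apply: val_inj; exact: rrngE. Qed.
Let esrcE k d t : esrc (twist_elt k d t) = twist_elt (rotate k d) (so_one R n) c1.
Proof. by apply: val_inj; exact: rsrcE. Qed.
Let einvE k d t : einv (twist_elt k d t) =
  twist_elt (rotate k d) (so_inv d) (cinv t).
Proof. by apply: val_inj; exact: rinvE. Qed.
Let emulE k d e s t :
  emul (twist_elt k d s) (twist_elt (rotate k d) e t) =
  twist_elt k (so_mul d e) (cmul s t).
Proof.
by apply: val_inj; rewrite /emul insubdK/= rmulE//; exact: twist_elt_subproof.
Qed.

(** Composability fixes only the line, so the representative of b can be chosen to be [rotate k d].
    The groupoid laws then reduce to those of the group, of [rotate] and of the circle. *)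
Let comp k d t b : esrc (twist_elt k d t) = erng b ->
  exists e s, b = twist_elt (rotate k d) e s.
Proof.
have [l [e [s ->]]] := twist_elt_surj b; rewrite esrcE erngE.
move=> /(congr1 (fun a : A => (val a).1.1))/= /esym le.
by have [r ->] := twist_elt_line e s le; exists e, r.
Qed.

Let erng_mul a b : esrc a = erng b -> erng (emul a b) = erng a.
Proof.
have [k [d [t ->]]] := twist_elt_surj a => /comp[e [s ->]].
by rewrite emulE !erngE.
Qed.
Let esrc_mul a b : esrc a = erng b -> esrc (emul a b) = esrc b.
Proof.
have [k [d [t ->]]] := twist_elt_surj a => /comp[e [s ->]].
by rewrite emulE !esrcE rotateM.
Qed.
Let emulA a b c : esrc a = erng b -> esrc b = erng c ->
  emul (emul a b) c = emul a (emul b c).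
Proof.
have [k [d [t ->]]] := twist_elt_surj a => /comp[e [s ->]] /comp[f [r ->]].
by rewrite emulE emulE rotateM !emulE so_mulA cmulA.
Qed.
Let erng_inv a : erng (einv a) = esrc a.
Proof. by have [k [d [t ->]]] := twist_elt_surj a; rewrite einvE erngE esrcE. Qed.
Let esrc_inv a : esrc (einv a) = erng a.
Proof.
have [k [d [t ->]]] := twist_elt_surj a; rewrite einvE erngE esrcE.
by rewrite rotateM so_mulV rotate1.
Qed.
Let emul_inv a : emul a (einv a) = erng a.
Proof.
have [k [d [t ->]]] := twist_elt_surj a; rewrite einvE erngE emulE.
by rewrite so_mulV cmulV.
Qed.
Let einv_mul a : emul (einv a) a = esrc a.
Proof.
have [k [d [t ->]]] := twist_elt_surj a; rewrite einvE esrcE.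
(* k is rewritten as its image under d and then d^-1, the representative that [emulE] expects. *)
rewrite [X in emul _ X](_ : _ = twist_elt (rotate (rotate k d) (so_inv d)) d t).
  by rewrite emulE so_Vmul cVmul.
by rewrite rotateM so_mulV rotate1.
Qed.
Let erng_unit a : emul (erng a) a = a.
Proof.
have [k [d [t ->]]] := twist_elt_surj a; rewrite erngE -{2}(rotate1 k) emulE.
by rewrite so_1mul c1mul.
Qed.
Let esrc_unit a : emul a (esrc a) = a.
Proof.
by have [k [d [t ->]]] := twist_elt_surj a; rewrite esrcE emulE so_mul1 cmul1.
Qed.

Definition twist_groupoid : groupoid :=
  @Groupoid (set_type twist_arrows : topologicalType) erng esrc einv emul
    erng_mul esrc_mul emulA erng_inv esrc_inv
    emul_inv einv_mul erng_unit esrc_unit.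
Notation E := twist_groupoid.

Lemma twist_rngE k d t : grng (twist_elt k d t : E) = twist_elt k (so_one R n) c1.
Proof. exact: erngE. Qed.
Lemma twist_srcE k d t : gsrc (twist_elt k d t : E) =
  twist_elt (rotate k d) (so_one R n) c1.
Proof. exact: esrcE. Qed.
Lemma twist_mulE k d e s t :
  gmul (twist_elt k d s : E) (twist_elt (rotate k d) e t : E) =
  twist_elt k (so_mul d e) (cmul s t).
Proof. exact: emulE. Qed.

Lemma twist_compP k d t (b : E) : gsrc (twist_elt k d t : E) = grng b ->
  exists e s, b = twist_elt (rotate k d) e s.
Proof. exact: comp. Qed.

(** Removes the default value of [emul], leaving a formula made of continuous operations. *)
Lemma twist_val_mul (a b : E) : gsrc a = grng b ->
  val (gmul a b : A) = (gmul (val (a : A)).1 (val (b : A)).1,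
    fib_mul (val (a : A)).2
      (fib_act (val (b : A)).2 (val (val (a : A)).1.2.1)^T)).
Proof.
have [k [d [s ->]]] := twist_elt_surj a => /twist_compP[e [t ->]].
rewrite twist_mulE /=; congr pair.
by rewrite fib_actE -mulmxA orthogonalP mulmx1 fibM//; exact: set_valP.
Qed.

Definition twist_proj (a : E) : G := (val (a : A)).1.

Lemma twist_proj_continuous : continuous twist_proj.
Proof. exact: continuousT_comp (@initial_continuous _ _ _) (@continuous_fst _ _). Qed.

Lemma twist_hausdorff : hausdorff_space E.
Proof.
apply: hausdorff_set_type; apply: hausdorff_prod.
  by have [] := projective_groupoid_hausdorff R n.
apply: hausdorff_prod; first exact: norm_hausdorff.
by apply: hausdorff_mx; exact: norm_hausdorff.
Qed.

Lemma twist_elt_continuous d :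
  continuous (fun p : S * circle R => twist_elt p.1 d p.2 : E).
Proof.
apply: continuous_set_val; apply: continuous_prod => /=.
  apply: continuous_prod; last exact: cst_continuous.
  exact: continuousT_comp (@continuous_fst _ _) (@line_continuous R n).
exact: fib_continuous.
Qed.

Lemma twist_group_continuous : continuous (fun a : E => (val (a : A)).1.2 : D).
Proof. exact: continuousT_comp twist_proj_continuous (@continuous_snd _ _). Qed.

(** The arrows with a given group component form an open set, the continuous image of the compact
    space S x T. *)
Lemma twist_locally_compact : locally_compact [set: E].
Proof.
apply: hausdorff_locally_compact; first exact: twist_hausdorff.
move=> a; exists [set b : E | (val (b : A)).1.2 = (val (a : A)).1.2 :> D].
  apply: (@twist_group_continuous a [set d | d = (val (a : A)).1.2]).
  exact: discrete_set1.
rewrite (_ : mkset _ =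
    range (fun p : S * circle R => twist_elt p.1 (val (a : A)).1.2 p.2)).
  apply: compact_image; first exact: twist_elt_continuous.
  rewrite -setXTT; apply: compact_setX; first exact: sphere_type_compact.
  by apply: compact_set_type; exact: circle_compact.
apply/seteqP; split=> [b|_ [p _ <-]//].
by have [k [d [t ->]]] := twist_elt_surj b => /= <-; exists (k, t).
Qed.

Lemma twist_hausdorff_groupoid : hausdorff_groupoid E.
Proof.
have cp : continuous (fun a : E => (val (a : A)).2 : W).
  exact: continuousT_comp (@initial_continuous _ _ _) (@continuous_snd _ _).
have cm : continuous (fun a : E => val (val (a : A)).1.2.1 : 'M[R]_n).
  exact: (continuousT_comp twist_group_continuous
    (@discrete_continuous _ _ (fun d : D => val d.1 : 'M[R]_n))).
split; [exact: twist_hausdorff|exact: twist_locally_compact| |].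
- apply/subspace_sigL_continuousP; apply: continuous_set_val.
  rewrite (_ : (fun x => _) = fun x : composable E =>
    (gmul (twist_proj (val x).1) (twist_proj (val x).2),
     fib_mul (val ((val x).1 : A)).2
       (fib_act (val ((val x).2 : A)).2 (val (val ((val x).1 : A)).1.2.1)^T))).
    have c1 : continuous (fun x : composable E => (val x).1).
      exact: continuousT_comp (@initial_continuous _ _ _) (@continuous_fst _ _).
    have c2 : continuous (fun x : composable E => (val x).2).
      exact: continuousT_comp (@initial_continuous _ _ _) (@continuous_snd _ _).
    apply: continuous_prod.
      have cmG : continuous (fun p : G * G => gmul p.1 p.2).
        exact: transformation_mul_continuous.
      exact: (continuousT_comp (continuous_prod
        (continuousT_comp c1 twist_proj_continuous)
        (continuousT_comp c2 twist_proj_continuous)) cmG).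
    exact: (fib_mul_continuous (continuousT_comp c1 cp)
      (fib_act_continuous (continuousT_comp c2 cp)
        (continuous_trmx (continuousT_comp c1 cm)))).
  by apply/funext => x; rewrite /sigL/= twist_val_mul//; exact: set_valP x.
- apply: continuous_set_val; apply: continuous_prod.
    have [_ _ _ ci] := projective_groupoid_hausdorff R n.
    exact: continuousT_comp twist_proj_continuous ci.
  exact: (fib_act_continuous
    (continuousT_comp cp (fib_conj_continuous)) cm).
Qed.

Lemma unit_line (u : units G) : exists k, val u = (line k, so_one R n).
Proof.
have /transformation_unitsP := set_valP u; case: (val u) => x d /= ->.
by have [k <-] := line_surj x; exists k.
Qed.

Lemma twist_iota_subproof (p : unit_bundle R G) :
  (val p.1, (val p.2, 0)) \in twist_arrows.
Proof.
rewrite inE; have [k ->] := unit_line p.1.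
by exists (k, so_one R n, p.2).
Qed.

Definition twist_iota (p : unit_bundle R G) : E := SigSub (twist_iota_subproof p).

Lemma twist_iotaE u k z : val u = (line k, so_one R n) ->
  twist_iota (u, z) = twist_elt k (so_one R n) z.
Proof. by move=> uk; apply: val_inj; rewrite /= uk. Qed.

Lemma twist_mul1E k e s t :
  gmul (twist_elt k (so_one R n) s : E) (twist_elt k e t : E) =
  twist_elt k e (cmul s t).
Proof. by have := twist_mulE k (so_one R n) e s t; rewrite rotate1 so_1mul. Qed.

Lemma twist_iota_hom : is_hom twist_iota.
Proof.
move=> [u z] [v w] [<-]; have [k uk] := unit_line u.
rewrite [gmul _ _](_ : _ = (u, cmul z w))// !(twist_iotaE _ uk).
rewrite twist_srcE twist_rngE rotate1; split=> //.
by rewrite twist_mul1E.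
Qed.

Lemma twist_proj_hom : is_hom twist_proj.
Proof.
move=> a b ab; split; last by rewrite /twist_proj twist_val_mul.
by have := congr1 twist_proj ab.
Qed.

Definition twist_extension : extension R (projective_etale R n) :=
  @Extension R (projective_etale R n) E twist_iota twist_proj
    twist_iota_hom twist_proj_hom (fun _ _ => erefl).

(** This expression is the phase t over [false], where the pairing vanishes, and t times its
    conjugate, that is 1, over [true], where the first component alone would be 0. It is thus
    defined and continuous on the whole twist, and recovers z from [twist_iota (u, z)]. *)
Lemma twist_circle_subproof (a : E) :
  (val (a : A)).2.1 + dot (val (a : A)).2.2 (fib_conj (val (a : A)).2).2
    \in circle R.
Proof.
have [k [d [t ->]]] := twist_elt_surj a; rewrite inE /circle/mkset.
rewrite (_ : val (twist_elt k d t) = ((line k, d), fib (val k) d.2 (val t)))//.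
rewrite [fib_conj _]fib_conjE /fib; case: d.2 => /=; last first.
  by rewrite dot0v addr0; exact: (set_valP t).
rewrite add0r dot_complexify; last exact: set_valP.
by rewrite normrM norm_conjC (set_valP t : `|_| = 1) mulr1.
Qed.

Definition twist_circle (a : E) : circle R := SigSub (twist_circle_subproof a).

Lemma twist_is_twist : is_twist twist_extension.
Proof.
split; first exact: twist_hausdorff_groupoid.
- split.
    apply: (@is_embedding_cancel _ _ _
      (fun a : E => (rng0 (twist_proj a), twist_circle a))).
    + apply: continuous_set_val; apply: continuous_prod.
        exact: continuousT_comp (@continuous_fst _ _) (@initial_continuous _ _ _).
      apply: continuous_prod; last exact: cst_continuous.
      exact: continuousT_comp (@continuous_snd _ _) (@initial_continuous _ _ _).
    + apply: continuous_prod.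
        exact: (continuousT_comp twist_proj_continuous
          (@rng0_continuous (projective_etale R n))).
      apply: continuous_set_val.
      have cp : continuous (fun a : E => (val (a : A)).2 : W).
        exact: continuousT_comp (@initial_continuous _ _ _) (@continuous_snd _ _).
      have cf2 := continuousT_comp cp (@continuous_snd _ _).
      apply: (continuousT_add (continuousT_comp cp (@continuous_fst _ _))).
      apply: (continuous_dot cf2); apply: continuousT_comp (@continuous_snd _ _).
      exact: continuousT_comp cp (fib_conj_continuous).
    + move=> [u z]; congr pair; apply: val_inj => /=.
        have /transformation_unitsP := set_valP u; rewrite /twist_proj/=.
        by case: (val u) => x d /= ->.
      by rewrite dot0v addr0.
  apply/seteqP; split=> [_ [p _ <-]|a] /=.
    by have := set_valP p.1.
  have [k [d [t ->]]] := twist_elt_surj a => /[dup] /transformation_unitsP /= -> ku.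
  by exists (SigSub (mem_set ku), t) => //; exact: twist_iotaE.
- split; first exact: twist_proj_continuous.
    move=> W' oW.
    (* Openness is checked upstairs: the projection after q is a coordinate projection followed by
       [line] times the identity, both open. *)
    pose q (p : S * D * circle R) : E := twist_elt p.1.1 p.1.2 p.2.
    have cq : continuous q.
      have cS : continuous (fun p : S * D * circle R => p.1.1).
        exact: (continuousT_comp (@continuous_fst _ _) (@continuous_fst _ _)).
      have cD : continuous (fun p : S * D * circle R => p.1.2).
        exact: (continuousT_comp (@continuous_fst _ _) (@continuous_snd _ _)).
      have cg : continuous
          (fun p : S * circle R * D => twist_elt p.1.1 p.2 p.1.2 : E).
        by apply: continuous_discretel => d; exact: twist_elt_continuous.
      exact: (continuousT_comp (continuous_prod
        (continuous_prod cS (@continuous_snd _ _)) cD) cg).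
    rewrite (_ : _ @` _ = (fun y : S * D => (line y.1, y.2) : G) @`
       (@fst (S * D) (circle R) @` (q @^-1` W'))).
      apply: (open_map_prodl (@line_open R n)); apply: open_map_fst.
      by apply: open_comp => // p _; exact: cq.
    apply/seteqP; split=> [_ [a Wa <-]|_ [_ [p Wp <-] <-]]; last by exists (q p).
    have [k [d [t e]]] := twist_elt_surj a; exists (k, d) => //; last by rewrite e.
    by exists (k, d, t) => //; rewrite /preimage/mkset /q/= -e.
  apply/seteqP; split=> // -[x d] _; have [k <-] := line_surj x.
  by exists (twist_elt k d c1).
- move=> a z; have [k [d [t ->]]] := twist_elt_surj a.
  have -> : ext_iota twist_extension
      (rng0 (@ext_proj R _ twist_extension (twist_elt k d t)), z) =
    twist_elt k (so_one R n) z by exact: twist_iotaE.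
  have -> : ext_iota twist_extension
      (src0 (@ext_proj R _ twist_extension (twist_elt k d t)), z) =
    twist_elt (rotate k d) (so_one R n) z.
    by apply: twist_iotaE; rewrite /= move_lineE.
  apply: etrans (twist_mul1E k d z t) _.
  (* Both products have group component d, so centrality is commutativity of the circle. *)
  by rewrite cmulC -[in LHS](so_mul1 d); exact: esym (twist_mulE _ _ _ _ _).
Qed.
End Twist.
Arguments twist_arrows : clear implicits.

(** * From a cocycle to an odd map *)

Theorem theoremA (R : realType) :
  exists (G : etale_groupoid) (E : extension R G),
    [/\ minimal G,
        is_twist E &
        ~ induced_by_cocycle
            (restriction E (isotropy_interior_subgroupoid G))].
Proof.
exists (projective_etale R 3), (twist_extension R 3); split.
- exact: projective_minimal.
- exact: twist_is_twist.
move=> [s [f [g [[fK gK] [_ cg] _ _ fproj]]]].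
pose gp := projective_etale R 3.
pose zflip : signed_orthogonal R 3 := ((so_one R 3).1, true).
have aI (k : sphere R 3) :
    ((line k, zflip) : gp) \in isotropy_interior gp.
  rewrite inE; apply: isotropy_interior_kernel => x.
  by apply: val_inj; exact: (congr1 val (move_line1 x)).
pose a (k : sphere R 3) : isotropy_interior gp := SigSub (aI k).
have ca : continuous a.
  apply: continuous_set_val; apply: continuous_prod; last exact: cst_continuous.
  exact: line_continuous.
(* A cocycle twist has the global section gamma |-> (gamma, 1); carried over by g and composed with
   a, it becomes a section of the circle bundle over RP^2, pulled back to the sphere. *)
pose b (k : sphere R 3) : twist_arrows R 3 := val (g (a k, c1)).
have cb : continuous b.
  have c1' : continuous (fun k => (a k, c1) : cocycle_extension s).
    by apply: continuous_prod => //; exact: cst_continuous.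
  exact: (continuousT_comp (continuousT_comp c1' cg) (@initial_continuous _ _ _)).
have bproj k : (val (b k)).1 = (line k, zflip).
  by have := congr1 val (fproj (g (a k, c1))); rewrite gK => /esym.
have bfib k : exists t : circle R,
    (val (b k)).2 = fib (val k) true (val t).
  have [l [d [t bE]]] := twist_elt_surj (b k).
  have := bproj k; rewrite bE => e.
  have lk : line l = line k := congr1 fst e.
  have d1 : d = zflip := congr1 snd e.
  have [r rE] := twist_elt_line d t lk; exists r.
  by rewrite rE/= d1.
have be k l : val k = - val l -> b k = b l.
  move=> kl; have -> : k = antipode l by exact: val_inj.
  by rewrite /b; congr (val (g (_, _))); apply: val_inj; rewrite /= line_antipode.
(* The vector in b k is t k with |t| = 1, and pairing it with k extracts t. Since b k depends only
   on the line of k, the sign of k makes h odd. *)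
pose h (k : sphere R 3) := dot (val (b k)).2.2 (complexify (val k)).
apply: (@no_odd_map_to_circle R h).
- apply: continuous_dot.
    have cv : continuous (fun k => val (b k)).
      exact: (continuousT_comp cb (@initial_continuous _ _ _)).
    exact: (continuousT_comp (continuousT_comp cv (@continuous_snd _ _))
      (@continuous_snd _ _)).
  by apply: complexify_continuous; exact: initial_continuous.
- move=> k; have [t bt] := bfib k; rewrite /h bt /=.
  rewrite -[complexify (val k) in X in dot _ X]scale1r.
  rewrite dot_complexify; last exact: set_valP.
  by rewrite mulr1; exact: (set_valP t).
- move=> k l kl; rewrite /h (be _ _ kl) kl /complexify map_mxN.
  by rewrite /dot linearN/= mulmxN mxE.
Qed.
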